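(* Let $p$ be a prime and $w,e\in\mathbb Z_{\ge0}$. Fix $Q\in\operatorname{Syl}_p(S_w)$, a subgroup $C_p\le S_p$ of order $p$, and let $P=C_p\wr Q\le S_p\wr S_w\le S_{pw}$. For $e'\ge0$ let $\mathcal S_{e'}=\mathcal S(S_{pw+e'},P,(S_p\wr S_w)\times S_{e'})$. Then (i) $\mathcal K_{w-1}\subseteq\mathcal I(S_p\wr S_w,P,\mathcal S_0)$; and (ii) if $e>0$, then $\mathcal K_w\subseteq\mathcal I(S_p\wr S_w,P,\mathcal S_e)$.
   Context: $S_p\wr S_w$ is embedded in $S_{pw}$ as the stabiliser of $\{[1,p],\dots,[(w-1)p+1,wp]\}$, and $S_{e'}$ permutes $\{pw+1,\dots,pw+e'\}$. $\mathcal S(G,P,H)$ is the set of subgroups of $P$ contained in ${}^gP\cap P$ for some $g\in G\setminus H$. For a downwards closed set $\mathcal S$ of subgroups of $P$, $\mathcal I(H,P,\mathcal S)$ is the subgroup of virtual characters of $H$ generated by $\operatorname{Ind}_L^H\phi$ with $L\le H$, $\phi$ a virtual character of $L$, $L\cap P\in\operatorname{Syl}_p(L)$ and $L\cap P\in\mathcal S$. Write elements of $S_p\wr S_w$ as $(x_1,\dots,x_w;\sigma)$; a marked cycle of $S_w$ is a non-identity cycle or a singleton $j\in[1,w]$ (acting trivially), with order $o(\sigma)$ = size of its support; $y_\sigma(x)=(1,\dots,x,\dots,1;\sigma)$ with $x$ in the position of the least support point. Every $h$ is conjugate to some $y_{\sigma_1}(x_1)\cdots y_{\sigma_r}(x_r)$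 with supports partitioning $[1,w]$; $\operatorname{tp}^{\mathrm{wr}}_p(h)$ is the partition of the $o(\sigma_l)$ for which $x_l$ is a $p$-cycle. $\mathcal U_s=\{h\in S_p\wr S_w:|\operatorname{tp}^{\mathrm{wr}}_p(h)|\ge s\}$ and $\mathcal K_s=\{\xi\in\mathbb Z[\operatorname{Irr}(S_p\wr S_w)]:\xi(h)=0\text{ for all }h\in\mathcal U_s\}$. *)

(* Defs.v *)
From HB Require Import structures.
From mathcomp Require Import all_boot all_order all_algebra all_fingroup all_solvable all_field all_character.
Set Implicit Arguments. Unset Strict Implicit. Unset Printing Implicit Defensive.
Import GRing.Theory Num.Theory.
Local Open Scope group_scope.
Local Open Scope cfun_scope.

(* Points of 'I_n are 0-indexed; block k (k < w) is [k*p, k*p+p-1];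
   the tail [p*w, n) is permuted by S_{e'} where n = p*w + e'. *)

Definition blocks (p w n : nat) : {set {set 'I_n}} :=
  [set [set i : 'I_n | (i < p * w) && (i %/ p == k)] | k : 'I_w].

Definition tailset (p w n : nat) : {set 'I_n} := [set i : 'I_n | p * w <= i].

(* S_p wr S_w inside S_n (n = p*w + e'): stabiliser of the set of blocks,
   fixing the tail pointwise. *)
Definition Wr (p w e' : nat) : {group {perm 'I_(p * w + e')}} :=
  ('C[blocks p w (p * w + e') | ('P^*)^*] :&: 'C(tailset p w (p * w + e') | 'P))%G.

(* (S_p wr S_w) x S_{e'} inside S_n: stabiliser of the set of blocks (and hence
   of the tail setwise). *)
Definition WrX (p w e' : nat) : {group {perm 'I_(p * w + e')}} :=
  ('C[blocks p w (p * w + e') | ('P^*)^*] :&: 'C[tailset p w (p * w + e') | 'P^*])%G.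

(* g is the element (x_0,...,x_{w-1}; s) of S_p wr S_w, acting by
   k*p + r |-> s(k)*p + x_k(r), and fixing the tail. *)
Definition wr_coords (p w n : nat) (g : {perm 'I_n}) (s : {perm 'I_w})
    (x : 'I_w -> {perm 'I_p}) : bool :=
  [forall i : 'I_n, (p * w <= i) ==> (g i == i)] &&
  [forall i : 'I_n, forall k : 'I_w, forall r : 'I_p,
     (val i == k * p + r) ==> (val (g i) == s k * p + x k r)].

(* P = C wr Q, for C <= S_p and Q <= S_w. *)
Definition PwrSet (p w e' : nat) (C : {group {perm 'I_p}}) (Q : {group {perm 'I_w}})
  : {set {perm 'I_(p * w + e')}} :=
  [set g | [exists s in Q, exists x : {ffun 'I_w -> {perm 'I_p}},
               [forall k, x k \in C] && @wr_coords p w _ g s x]].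

Definition Pwr (p w e' : nat) (C : {group {perm 'I_p}}) (Q : {group {perm 'I_w}})
  : {group {perm 'I_(p * w + e')}} := <<@PwrSet p w e' C Q>>%G.

(* x in S_p is a p-cycle *)
Definition pcycle (p : nat) (x : {perm 'I_p}) : bool :=
  [exists i : 'I_p, #|porbit x i| == p].

(* k is the least point of its s-cycle (a marked cycle) *)
Definition least_pt (w : nat) (s : {perm 'I_w}) (k : 'I_w) : bool :=
  [forall j in porbit s k, k <= j].

(* (x; s) is a product y_{s_1}(x_1) ... y_{s_r}(x_r): x_j = 1 unless j is the
   least point of its s-cycle. *)
Definition normal_form (p w : nat) (s : {perm 'I_w}) (x : 'I_w -> {perm 'I_p}) : Prop :=
  forall k : 'I_w, x k != 1%g -> least_pt s k.

(* |tp^wr_p| of (x; s) in normal form: sum of the o(s_l) with x_l a p-cycle *)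
Definition tp_size (p w : nat) (s : {perm 'I_w}) (x : 'I_w -> {perm 'I_p}) : nat :=
  \sum_(k : 'I_w | least_pt s k && pcycle (x k)) #|porbit s k|.

(* h in U_s *)
Definition inU (p w e' s : nat) (h : {perm 'I_(p * w + e')}) : Prop :=
  h \in Wr p w e' /\
  exists2 t, t \in Wr p w e' &
    exists sg : {perm 'I_w}, exists x : 'I_w -> {perm 'I_p},
      [/\ @wr_coords p w _ (h ^ t) sg x, normal_form sg x & s <= tp_size sg x].

(* K_s *)
Definition inK (p w e' s : nat) (xi : 'CF(Wr p w e')) : Prop :=
  xi \in 'Z[irr (Wr p w e')] /\
  forall h, @inU p w e' s h -> xi h = 0%R.

(* S(G,P,H) *)
Definition Sfam (gT : finGroupType) (G P H : {set gT}) (L : {set gT}) : Prop :=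
  L \subset P /\ exists2 g, g \in G :\: H & L \subset (P :^ g^-1) :&: P.

(* generators of I(H,P,S) *)
Definition Igen (gT : finGroupType) (p : nat) (H P : {group gT})
    (S : {set gT} -> Prop) (psi : 'CF(H)) : Prop :=
  exists L : {group gT},
    [/\ L \subset H, (L :&: P)%G \in 'Syl_p(L), S (L :&: P) &
        exists2 phi : 'CF(L), phi \in 'Z[irr L] & psi = ('Ind[H] phi)%R].

(* I(H,P,S): the additive subgroup generated (finite sums of generators; the
   generating set is closed under negation). *)
Definition inI (gT : finGroupType) (p : nat) (H P : {group gT})
    (S : {set gT} -> Prop) (psi : 'CF(H)) : Prop :=
  exists2 l : seq 'CF(H), (forall y, y \in l -> Igen p P S y) & psi = (\sum_(y <- l) y)%R.

(* Main.v *)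
(* Let W = S_p wr S_w. A partial transversal is a set of points with at most one
   point in each block. If a p-subgroup R of W fixes a partial transversal U with
   |U| >= 2, or with |U| >= 1 when e > 0, then some permutation centralises R
   without preserving the block system: move a point u of U inside its R-orbit by
   an element normalising, but not lying in, the stabiliser of u (or exchange two
   fixed points in different blocks). Hence it is enough to write xi as a sum of
   characters induced from subgroups L such that every p-subgroup of L fixes a
   partial transversal of size at least c, where c = 2 for (i) and c = 1 for (ii).

   By Solomon's theorem, 1 is a combination of characters induced from
   quasi-elementary subgroups H. On a block where H acts with order divisible by p,
   this action has a normal Sylow p-subgroup, of order p. The product V of these
   is normalised by H, and H may be replaced by F = HV. If xi vanishes at all
   elements of F fixing no nonempty partial transversal of these blocks, then
     sum_(U, gU = U) (-1)^(number of g-orbits on U) |V_U|^-1 sum_(v in V_U) xi(vg) = 0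
   for g in F, where V_U is the part of V supported on the blocks met by U. The
   term of the empty U is xi(g), and the others, grouped by F-orbits, are
   virtual characters induced from stabilisers of nonempty U. An induction on c,
   applied to these stabilisers, gives the general case. On the other blocks every
   p-subgroup of H has a fixed point automatically. *)

Require Import Defs.
From HB Require Import structures.
From mathcomp Require Import all_boot all_order all_algebra all_fingroup all_solvable all_field all_character.

Set Implicit Arguments. Unset Strict Implicit. Unset Printing Implicit Defensive.
Import GRing.Theory Num.Theory.
Local Open Scope group_scope.

(** * Solomon's induction theorem *)

Definition ind_span (gT : finGroupType) (Fam : {group gT} -> Prop)
    (G : {group gT}) (xi : 'CF(G)) : Prop :=
  exists2 l : seq 'CF(G),
    (forall y, y \in l -> exists L : {group gT}, [/\ L \subset G, Fam L &
       exists2 phi : 'CF(L), phi \in 'Z[irr L] & y = ('Ind[G] phi)%R])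
    & xi = (\sum_(y <- l) y)%R.

Section IndSpan.

Local Open Scope ring_scope.

Variable gT : finGroupType.
Implicit Types (G H L : {group gT}) (Fam : {group gT} -> Prop).

Lemma ind_span_gen Fam G L (phi : 'CF(L)) :
  L \subset G -> Fam L -> phi \in 'Z[irr L] -> ind_span Fam ('Ind[G] phi).
Proof.
move=> sLG FL Zphi; exists [:: 'Ind[G] phi]; last by rewrite big_seq1.
by move=> y; rewrite inE => /eqP->; exists L; split=> //; exists phi.
Qed.

Lemma ind_span0 Fam G : ind_span Fam (0 : 'CF(G)).
Proof. by exists [::]; rewrite ?big_nil. Qed.

Lemma ind_spanD Fam G (f g : 'CF(G)) :
  ind_span Fam f -> ind_span Fam g -> ind_span Fam (f + g).
Proof.
move=> [l1 H1 ->] [l2 H2 ->]; exists (l1 ++ l2); last by rewrite big_cat.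
by move=> y; rewrite mem_cat => /orP[/H1|/H2].
Qed.

Lemma ind_span_sum Fam G (J : Type) (r : seq J) (P : pred J) (f : J -> 'CF(G)) :
  (forall j, P j -> ind_span Fam (f j)) -> ind_span Fam (\sum_(j <- r | P j) f j).
Proof.
by move=> Hf; elim/big_ind: _ => //; [exact: ind_span0 | exact: ind_spanD].
Qed.

Lemma ind_spanN Fam G (f : 'CF(G)) : ind_span Fam f -> ind_span Fam (- f).
Proof.
move=> [l Hl ->]; rewrite -sumrN big_seq; apply: ind_span_sum => y ly.
have [L [sLG FL [phi Zphi ->]]] := Hl y ly.
by rewrite -linearN; apply: ind_span_gen; rewrite ?rpredN.
Qed.

Lemma ind_span_Ind Fam G H (f : 'CF(H)) :
  H \subset G -> ind_span Fam f -> ind_span Fam ('Ind[G] f).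
Proof.
move=> sHG [l Hl ->]; rewrite linear_sum /= big_seq; apply: ind_span_sum => y ly.
have [L [sLH FL [phi Zphi ->]]] := Hl y ly.
by rewrite cfIndInd //; apply: ind_span_gen; rewrite ?(subset_trans sLH).
Qed.

Lemma ind_span_trans Fam Fam' G (f : 'CF(G)) :
  (forall L (phi : 'CF(L)), L \subset G -> Fam L -> phi \in 'Z[irr L] ->
     ind_span Fam' ('Ind[G] phi)) ->
  ind_span Fam f -> ind_span Fam' f.
Proof.
move=> HF [l Hl ->]; rewrite big_seq; apply: ind_span_sum => y ly.
by have [L [sLG FL [phi Zphi ->]]] := Hl y ly; apply: HF.
Qed.

(** By the projection formula, [Ind phi * xi] is induced from [phi * Res xi], so the span is an
    ideal. *)
Lemma ind_span_mull Fam G (f xi : 'CF(G)) :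
  xi \in 'Z[irr G] -> ind_span Fam f -> ind_span Fam (f * xi).
Proof.
move=> Zxi [l Hl ->]; rewrite mulr_suml big_seq; apply: ind_span_sum => y ly.
have [L [sLG FL [phi Zphi ->]]] := Hl y ly.
by rewrite -cfIndM //; apply: ind_span_gen; rewrite // mul_vchar // cfRes_vchar.
Qed.

End IndSpan.

Section Solomon.

Local Open Scope ring_scope.

Variables (gT : finGroupType) (G : {group gT}).

(** A cyclic q'-group extended by a q-group. Asking for the quotient instead of a complement makes
    the notion pass directly to subgroups and images. *)
Definition quasi_elementary (q : nat) (H : {group gT}) : Prop :=
  exists C : {group gT}, [/\ cyclic C, C <| H, q^'.-group C & q.-group (H / C)].

Lemma cfun_mulrz (f : 'CF(G)) (z : int) x : (f *~ z) x = z%:~R * f x.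
Proof.
have E k: (f *+ k) x = k%:R * f x.
  by elim: k => [|k IH]; rewrite ?mulr0n ?cfunE ?mul0r // !mulrS cfunE IH mulrDl mul1r.
by case: z => k; rewrite ?NegzE ?mulrNz ?mulNr -!pmulrn ?cfunE ?mulrNz ?mulNr ?E.
Qed.

(* Banaschewski's lemma, in contrapositive form. *)
Lemma int_ring_has_one (A : 'CF(G) -> Prop) :
    (forall f g, A f -> A g -> A (f - g)) -> (forall f g, A f -> A g -> A (f * g)) ->
    (forall f x, A f -> exists m : int, f x = m%:~R) ->
    (forall x q, x \in G -> prime q ->
       exists2 f, A f & exists2 m : int, f x = m%:~R & ~~ (q %| `|m|)%N) ->
  A 1.
Proof.
move=> AB AM Aint Aloc.
have A0: A 0.
  by have [f Af _] := Aloc 1%g 2%N (group1 G) isT; rewrite -(subrr f); apply: AB.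
have AN f: A f -> A (- f) by move=> Af; rewrite -(add0r (- f)); apply: AB.
have AD f g: A f -> A g -> A (f + g).
  by move=> Af Ag; rewrite -(opprK g); apply: AB => //; apply: AN.
have AMn f k: A f -> A (f *+ k).
  by move=> Af; elim: k => [|k IH]; rewrite ?mulr0n // mulrS; apply: AD.
have AMz f (z : int): A f -> A (f *~ z).
  by move=> Af; case: z => k; rewrite ?NegzE ?mulrNz -pmulrn; try apply: AN; apply: AMn.
(* The values at [x] form a subgroup of the integers contained in no [qZ]. Descent: a nonzero value
   with a prime factor [q] is replaced by its gcd with a value prime to [q]. *)
have val1 x: x \in G -> exists2 f, A f & f x = 1.
  move=> Gx.
  have [f0 Af0 [m0 Dm0 nm0]] := Aloc x 2%N Gx isT.
  have {nm0}: (0 < `|m0|)%N by rewrite lt0n; apply: contraNneq nm0 => ->.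
  have [n] := ubnP `|m0|%N.
  elim: n => // n IH in f0 Af0 m0 Dm0 * => lt_m0n m0_gt0.
  have [m1 | ne1] := eqVneq `|m0|%N 1%N.
    exists (f0 *~ m0); first exact: AMz.
    by rewrite cfun_mulrz Dm0 -intrM; case: (m0) m1 => [[|[|?]]|[|?]].
  have m0gt1: (1 < `|m0|)%N by rewrite ltn_neqAle eq_sym ne1.
  have pr_q := pdiv_prime m0gt1; set q := pdiv _ in pr_q.
  have [f1 Af1 [m1 Dm1 nqm1]] := Aloc x q Gx pr_q.
  have [u [v Duv]] := Bezoutz m0 m1.
  apply: (IH (f0 *~ u + f1 *~ v) _ (gcdz m0 m1)).
  - by apply: AD; apply: AMz.
  - by rewrite -Duv cfunE !cfun_mulrz Dm0 Dm1 -!intrM -intrD.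
  - rewrite ltnS in lt_m0n; apply: leq_trans lt_m0n; rewrite /gcdz absz_nat.
    rewrite ltn_neqAle dvdn_leq ?dvdn_gcdl // andbT.
    apply: contraNneq nqm1 => eq_m0; apply: dvdn_trans (pdiv_dvd _) _.
    by rewrite -{1}eq_m0 dvdn_gcdr.
  by rewrite /gcdz absz_nat gcdn_gt0 m0_gt0.
have [f Af f1]: exists2 f, A f & {in enum G, forall x, f x = 1}.
  have: {subset enum G <= G} by move=> x; rewrite mem_enum.
  elim: (enum G) => [|x s IH] sG; first by exists 0.
  have [|f Af f1] := IH; first by move=> y sy; rewrite sG // inE sy orbT.
  have [|h Ah h1] := val1 x; first by rewrite sG ?mem_head.
  (* This is [1 - (1 - f) * (1 - h)], which takes the value 1 wherever [f] or [h] does. *)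
  exists (f + h - f * h); first by apply: AB; [apply: AD | apply: AM].
  move=> y; rewrite inE !cfunE => /predU1P[-> | /f1->]; first by rewrite h1 mulr1 addrAC subrr add0r.
  by rewrite mul1r addrK.
suff <-: f = 1 by [].
by apply/cfun_inP=> x Gx; rewrite f1 ?mem_enum // cfun1E Gx.
Qed.

Local Open Scope group_scope.

(** Up to inverting [y], the condition says that [u] fixes the coset [H :* y] under right
    translation, and each fixed coset accounts for [#|H|] elements. *)
Lemma count_cosets (N H : {group gT}) (u : gT) : H \subset N -> u \in N ->
  #|[set y in N | u ^ y \in H]| =
  (#|'Fix_(rcosets H N | 'Rs)(<[u]>)| * #|H|)%N.
Proof.
move=> sHN Nu; rewrite -(card_invg [set y in N | _]) -sum1_card.
pose R := rcosets H N; pose F := 'Fix_(R | 'Rs)(<[u]>).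
have memF y: y \in N -> (H :* y \in F) = (u ^ y^-1 \in H).
  move=> Ny; rewrite inE mem_rcosets // (subsetP (mulG_subr _ _)) //=.
  rewrite afix_cycle ?in_setT //.
  apply/afix1P/idP => /= [E | Hu].
    have: y * u \in H :* y by rewrite -E rcosetE -rcosetM rcoset_refl.
    by rewrite mem_rcoset conjgE invgK mulgA.
  by rewrite rcosetE -rcosetM; apply/rcoset_eqP; rewrite mem_rcoset; rewrite conjgE invgK mulgA in Hu.
rewrite (partition_big (fun y => H :* y) (mem F)) /=; last first.
  move=> y; rewrite mem_invg inE groupV => /andP[Ny Hu].
  by change (H :* y \in F); rewrite memF.
rewrite -sum_nat_const; apply: eq_bigr => X FX; rewrite sum1_card.
have /setIP[/rcosetsP[z Nz DX] _] := FX.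
rewrite -(card_rcoset H z) -DX; apply: eq_card => y; rewrite -topredE /= mem_invg inE.
apply/andP/idP => [[_ /eqP<-] | Xy]; first exact: rcoset_refl.
have Ny: y \in N.
  by move: Xy; rewrite DX => /rcosetP[h Hh ->]; rewrite groupM // (subsetP sHN).
have E: H :* y = X by rewrite DX; apply/rcoset_eqP; rewrite -DX.
by rewrite E groupV Ny -memF // E FX.
Qed.

Lemma Ind1E (H : {group gT}) x : H \subset G ->
  ('Ind[G, H] 1 x = #|H|%:R^-1 * #|[set y in G | (x ^ y)%g \in H]|%:R)%R.
Proof.
move=> sHG; rewrite cfIndE //; congr (_ * _)%R; rewrite -sum1_card natr_sum.
rewrite (eq_bigl (fun y => (y \in G) && (x ^ y \in H))); last by move=> y; rewrite inE.
by rewrite big_mkcondr; apply: eq_bigr => y _; rewrite cfun1E; case: (_ \in H).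
Qed.

(** Take [H = C Q0] with [C] generated by the q'-part of [x] and [Q0] a Sylow q-subgroup of
    [N = N_G(C)] containing the q-part. The value at [x] counts the cosets of [H] in [N] fixed by a
    q-element, so modulo [q] it is the index of [H] in [N], which is prime to [q]. *)
Lemma Ind1_not_dvd x q : x \in G -> prime q ->
  exists H : {group gT}, [/\ H \subset G, quasi_elementary q H &
    exists2 m : nat, ('Ind[G, H] 1 x = m%:R)%R & ~~ (q %| m)%N].
Proof.
move=> Gx pr_q; pose C := <[x.`_q^']>%G; pose N := 'N_G(C)%G.
have Gxpi pi: x.`_pi \in G by rewrite groupX.
have sCG: C \subset G by rewrite cycle_subG.
have sCN: C \subset N by rewrite subsetI sCG normG.
have Nxq: x.`_q \in N.
  rewrite inE Gxpi (subsetP (cent_sub _)) // cent_cycle.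
  by apply/cent1P; apply: commuteX2.
have q'C: q^'.-group C by rewrite /pgroup -orderE; apply: p_elt_constt.
have [|Q0 sylQ sxQ] := @Sylow_superset q _ N <[x.`_q]>%G _ (p_elt_constt _ _).
  by rewrite cycle_subG.
have sQN := pHall_sub sylQ.
pose H := (C <*> Q0)%G; have sHN: H \subset N by rewrite join_subG sCN.
have sHG: H \subset G by rewrite (subset_trans sHN) ?subsetIl.
have nCH: C <| H by rewrite /normal joing_subl (subset_trans sHN) ?subsetIr.
have qHC: q.-group (H / C).
  rewrite /= quotientYidl; first exact: quotient_pgroup (pHall_pgroup sylQ).
  by rewrite (subset_trans sQN) ?subsetIr.
exists H; split=> //; first by exists C; split=> //; apply: cycle_cyclic.
exists #|'Fix_(rcosets H N | 'Rs)(<[x.`_q]>)|.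
  (* [C] is the normal Hall q'-subgroup of [H], so [x ^ y] lies in [H] only if [y] normalises
     [C]. *)
  rewrite Ind1E //; have ->: [set y in G | x ^ y \in H] = [set y in N | x.`_q ^ y \in H].
    apply/setP=> y; rewrite !inE -andbA; have [Gy /=|//] := boolP (y \in G).
    have hallC: q^'.-Hall(H) C.
      rewrite /pHall normal_sub //= -card_quotient ?normal_norm // pnatNK.
      by apply/andP; split.
    have xyq pi: x.`_pi ^ y = (x ^ y).`_pi by rewrite consttJ.
    apply/idP/andP => [Hxy | [nCy Hxq]].
      have Hpi pi: x.`_pi ^ y \in H by rewrite xyq groupX.
      split; last exact: Hpi.
      have sCyH: (C :^ y)%G \subset H by rewrite /= -cycleJ cycle_subG Hpi.
      by change ((C :^ y)%G \subset C); rewrite (sub_normal_Hall hallC) //= pgroupJ.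
    have Hq'y: x.`_q^' ^ y \in H.
      by rewrite (subsetP (joing_subl _ _)) // (subsetP nCy) // memJ_conjg cycle_id.
    have: (x.`_q * x.`_q^') ^ y \in H by rewrite conjMg groupM.
    by rewrite consttC.
  by rewrite (count_cosets sHN Nxq) natrM mulrCA mulVf ?mulr1 // neq0CG.
have /= E := @pgroup_fix_mod _ _ _ 'Rs%act q <[x.`_q]>%G (rcosets H N) (p_elt_constt _ _).
rewrite /dvdn -E; last first.
  by rewrite cycle_subG (subsetP (actsRs_rcosets _ _)).
rewrite -/(q %| _)%N -/(#|N : H|) -prime.p'natE //.
have /and3P[_ _] := sylQ; apply: pnat_dvd.
by rewrite indexgS ?joing_subr.
Qed.

Local Open Scope ring_scope.

(* Working with the integer-valued members of the
   ideal [ind_span], rather than with the span of the permutation characters,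
   makes closure under products immediate, without Mackey's formula. *)
Theorem cfun1_ind_quasi_elementary :
  ind_span (fun H => exists2 q, prime q & quasi_elementary q H) (1 : 'CF(G)).
Proof.
pose Fam := fun H : {group gT} => exists2 q, prime q & quasi_elementary q H.
pose A (f : 'CF(G)) := ind_span Fam f /\ forall x, exists m : int, f x = m%:~R.
suff [] : A 1 by [].
have span_vchar f : ind_span Fam f -> f \in 'Z[irr G].
  case=> l Hl ->; rewrite big_seq rpred_sum // => y /Hl[L [_ _ [phi Zphi ->]]].
  exact: cfInd_vchar.
apply: int_ring_has_one.
- move=> f g [If Zf] [Ig Zg]; split; first by apply: ind_spanD => //; apply: ind_spanN.
  by move=> x; have [[m Dm] [n Dn]] := (Zf x, Zg x); exists (m - n); rewrite !cfunE Dm Dn intrB.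
- move=> f g [If Zf] [Ig Zg]; split; first by apply: ind_span_mull => //; apply: span_vchar.
  by move=> x; have [[m Dm] [n Dn]] := (Zf x, Zg x); exists (m * n); rewrite !cfunE Dm Dn intrM.
- by move=> f x [].
move=> x q Gx pr_q; have [H [sHG qH [m Dm nqm]]] := Ind1_not_dvd Gx pr_q.
exists ('Ind[G, H] 1); last by exists m%:Z; rewrite ?Dm.
split; first by apply: ind_span_gen; [|exists q|apply: cfun1_vchar].
move=> y; have: 'Ind[G, H] 1 y \in Num.int.
  rewrite Cint_rat_Aint ?Aint_vchar ?cfInd_vchar ?cfun1_vchar //.
  by rewrite Ind1E // rpredM ?rpredV ?rpred_nat.
by move/intrP.
Qed.

End Solomon.

Lemma ind_span_quasi_elementary (gT : finGroupType) (Fam : {group gT} -> Prop)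
    (G : {group gT}) (xi : 'CF(G)) :
    (forall (H : {group gT}) q (phi : 'CF(H)), H \subset G -> prime q ->
       quasi_elementary q H -> phi \in 'Z[irr H] ->
       ind_span Fam ('Ind[G] (phi * 'Res[H] xi))%R) ->
  ind_span Fam xi.
Proof.
move=> Fxi; rewrite -(mul1r xi); have [l Hl ->] := cfun1_ind_quasi_elementary G.
rewrite mulr_suml big_seq; apply: ind_span_sum => y ly.
have [H [sHG [q pr_q qH] [phi Zphi ->]]] := Hl y ly.
by rewrite -cfIndM //; apply: (Fxi H q).
Qed.

(** * Partial transversals and the signed average formula *)

Section PartialTransversals.

Variables (T I : finType) (lab : T -> I).
Implicit Types (g h v : {perm T}) (U : {set T}) (D W : {set I}) (F V : {group {perm T}}).

Definition ptrans W U := (lab @: U \subset W) && (#|lab @: U| == #|U|).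

Lemma ptransP W U :
  reflect ({in U, forall x, lab x \in W} /\ {in U &, injective lab}) (ptrans W U).
Proof.
apply: (iffP andP) => [[/subsetP sUW /imset_injP injU] | [sUW injU]]; split=> //.
- by move=> x Ux; apply/sUW/imset_f.
- by apply/subsetP=> _ /imsetP[x Ux ->]; apply: sUW.
by apply/imset_injP.
Qed.

(** For [D = lab @: U] this is the part of [V] supported on the blocks met by [U]. *)
Definition fixing V D : {group {perm T}} := 'C_V([set x | lab x \notin D] | 'P)%G.

Lemma fixingP V D v :
  reflect (v \in V /\ forall x, lab x \notin D -> v x = x) (v \in fixing V D).
Proof.
apply: (iffP setIP) => [[Vv /astabP Cv] | [Vv Cv]]; split=> //.
  by move=> x Dx; apply: (Cv x); rewrite inE.
by apply/astabP=> x; rewrite inE; apply: Cv.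
Qed.

Lemma imset_permM (g h : {perm T}) U : (g * h) @: U = h @: (g @: U).
Proof. by rewrite -imset_comp; apply: eq_imset => x; rewrite /= permM. Qed.

Lemma imset_permK (g : {perm T}) U : g^-1 @: (g @: U) = U.
Proof. by rewrite -imset_permM mulgV imset_perm1. Qed.

Lemma imset_permKV (g : {perm T}) U : g @: (g^-1 @: U) = U.
Proof. by rewrite -imset_permM mulVg imset_perm1. Qed.

Lemma imset_permJ (g h : {perm T}) U : ((g ^ h) @: (h @: U) == h @: U) = (g @: U == U).
Proof.
rewrite -imset_permM conjgE mulKVg imset_permM.
exact: (inj_eq (imset_inj (@perm_inj _ h))).
Qed.

Lemma astabs_permP g U : reflect (g @: U = U) (g \in 'N(U | 'P)).
Proof.
apply: (iffP idP) => [Ng | gU].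
  by have := astabs_setact Ng; rewrite setactE.
by rewrite -astab1_set; apply/astab1P; rewrite /= setactE.
Qed.

(* [lab] records the block of each point, [W] is a set of blocks permuted by [F],
   and [V] is a normal subgroup of [F] acting regularly on the transversals of
   every subset of [W]. *)
Record block_setting F V W : Prop := BlockSetting {
  bs_normal : V <| F;
  bs_lab : forall g x y, g \in F -> lab x = lab y -> lab (g x) = lab (g y);
  bs_W : forall g x, g \in F -> lab x \in W -> lab (g x) \in W;
  bs_labV : forall v x, v \in V -> lab (v x) = lab x;
  bs_free : forall v x y, v \in V -> lab x = lab y -> v x = x -> v y = y;
  bs_trans : forall U U', ptrans W U -> ptrans W U' -> lab @: U = lab @: U' ->
    exists2 v, v \in fixing V (lab @: U) & v @: U = U'
}.

Definition orbit_sign U g : algC := ((-1) ^+ #|[set porbit g u | u in U]|)%R.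

Lemma porbitJ g h x : porbit (g ^ h) (h x) = h @: porbit g x.
Proof.
apply/setP=> y; apply/porbitP/imsetP => [[i ->] | [_ /porbitP[i ->] ->]].
  by exists ((g ^+ i) x); rewrite ?mem_porbit // -conjXg permJ.
by exists i; rewrite -conjXg permJ.
Qed.

Lemma orbit_signJ U g h : orbit_sign (h @: U) (g ^ h) = orbit_sign U g.
Proof.
rewrite {1}/orbit_sign.
have ->: [set porbit (g ^ h) u | u in h @: U] =
         [set h @: O | O : {set T} in [set porbit g u | u in U]].
  by rewrite -!imset_comp; apply: eq_imset => x; rewrite /= porbitJ.
by rewrite /orbit_sign card_imset //; apply: imset_inj; apply: perm_inj.
Qed.

Lemma porbit_sub g U x : g @: U = U -> x \in U -> porbit g x \subset U.
Proof.
move=> gU Ux; apply/subsetP=> _ /porbitP[i ->].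
elim: i => [|i IH]; first by rewrite expg0 perm1.
by rewrite expgSr permM -gU imset_f.
Qed.

Lemma imset_porbit g x : g @: porbit g x = porbit g x.
Proof.
apply/eqP; rewrite eqEcard card_imset ?leqnn ?andbT; last exact: perm_inj.
apply/subsetP=> _ /imsetP[_ /porbitP[i ->] ->].
by rewrite -permM -expgSr mem_porbit.
Qed.

Lemma eq_porbit g h x : {in porbit h x, g =1 h} -> porbit g x = porbit h x.
Proof.
move=> Egh; have E i: (g ^+ i) x = (h ^+ i) x.
  by elim: i => // i IH; rewrite !expgSr !permM IH Egh // mem_porbit.
by apply/setP=> y; apply/porbitP/porbitP=> [] [i ->]; exists i.
Qed.

Lemma orbit_signU U g x : g @: U = U -> x \notin U ->
  orbit_sign (U :|: porbit g x) g = (- orbit_sign U g)%R.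
Proof.
move=> gU U'x; rewrite /orbit_sign imsetU setUC.
have ->: [set porbit g u | u in porbit g x] = [set porbit g x].
  apply/setP=> O; rewrite inE; apply/imsetP/eqP=> [[y xy ->] | ->].
    by apply/eqP; rewrite eq_porbit_mem.
  by exists x; rewrite ?porbit_id.
rewrite cardsU1; case: imsetP => [[y Uy xy] | _]; last by rewrite exprS mulN1r.
case/negP: U'x; apply: (subsetP (porbit_sub gU Uy)).
by rewrite -xy porbit_id.
Qed.

Lemma fixing_sub V D D' : D \subset D' -> fixing V D \subset fixing V D'.
Proof.
move=> sDD'; apply/subsetP=> v /fixingP[Vv Cv]; apply/fixingP; split=> // x D'x.
by apply: Cv; apply: contra D'x; apply: (subsetP sDD').
Qed.

Section Formula.

Variables (F V : {group {perm T}}) (W : {set I}).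
Hypothesis FVW : block_setting F V W.

Lemma block_sub : V \subset F. Proof. exact: normal_sub (bs_normal FVW). Qed.

Lemma block_memJ v g : v \in V -> g \in F -> v ^ g \in V.
Proof. by move=> Vv Fg; rewrite memJ_norm // (subsetP (normal_norm (bs_normal FVW))). Qed.

Lemma ptrans_imset g U : g \in F -> ptrans W U -> ptrans W (g @: U).
Proof.
move=> Fg /ptransP[UW injU]; apply/ptransP; split=> [_ /imsetP[x Ux ->] | ].
  exact: bs_W FVW _ _ Fg (UW x Ux).
move=> _ _ /imsetP[x Ux ->] /imsetP[y Uy ->] Exy; congr (g _); apply: injU => //.
have := bs_lab FVW (groupVr Fg) Exy; by rewrite !permK.
Qed.

Lemma lab_imsetV v U : v \in V -> lab @: (v @: U) = lab @: U.
Proof. by move=> Vv; rewrite -imset_comp; apply: eq_imset => x; rewrite /= (bs_labV FVW). Qed.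

(** Since [v] preserves [U] and all labels, it fixes the single point of [U] in each block met by
    [U], hence by freeness the whole block. *)
Lemma fixing_free v U : v \in fixing V (lab @: U) -> v @: U = U -> 
  {in U &, injective lab} -> v = 1.
Proof.
case/fixingP=> Vv Cv vU injU; apply/permP=> y; rewrite perm1.
have [/imsetP[x Ux Exy] | ] := boolP (lab y \in lab @: U); last exact: Cv.
apply: (bs_free FVW Vv (esym Exy)); apply: injU => //; last exact: bs_labV FVW _ _ Vv.
by rewrite -[in X in _ \in X]vU imset_f.
Qed.

Lemma fixing_conj v g U : g \in F ->
  (v ^ g \in fixing V (lab @: (g @: U))) = (v \in fixing V (lab @: U)).
Proof.
have sub w k (A : {set T}): k \in F -> w \in fixing V (lab @: A) -> w ^ k \in fixing V (lab @: (k @: A)).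
  move=> Fk /fixingP[Vw Cw]; apply/fixingP; split=> [|x Dx]; first exact: block_memJ.
  rewrite -(permKV k x) permJ Cw //; apply: contra Dx => /imsetP[y Ay Exy].
  by have:= bs_lab FVW Fk Exy; rewrite permKV => ->; do 2!apply: imset_f.
move=> Fg; apply/idP/idP=> [ /(sub _ _ _ (groupVr Fg)) | ]; last exact: sub.
by rewrite conjgK imset_permK.
Qed.

End Formula.

End PartialTransversals.

(* [toggle_sum g h U] collects the coefficients with which [h] occurs, as
   [v * g ^ y] with [v] in [fixing lab V (lab @: U)], in the contributions of [U]
   to the signed averages at the conjugates [g ^ y]. Up to its normalisation it
   depends only on the set of blocks met by [U]; adding the [h]-orbit [O] to [U]
   changes its sign, so everything cancels as soon as [h] fixes such an [O]. *)
Section ToggleOrbit.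

Variables (T I : finType) (lab : T -> I) (F V : {group {perm T}}) (W : {set I}).
Implicit Types (U : {set T}) (D : {set I}).
Hypothesis FVW : block_setting lab F V W.
Variables g h : {perm T}.
Hypotheses (Fg : g \in F) (Fh : h \in F).

Let VU (U : {set T}) := fixing lab V (lab @: U).

Definition toggle_term y (U : {set T}) : algC :=
  if ((g ^ y) @: U == U) && (h * (g ^ y)^-1 \in VU U) then orbit_sign U (g ^ y) else 0%R.

Definition toggle_sum (U : {set T}) : algC := (\sum_(y in V) toggle_term y U)%R.

Let sVF := block_sub FVW.

(** Replace [y] by [y * z] in the sum. This alters [h * (g ^ y)^-1] by a right factor in [VU U],
    because [g ^ y] preserves [U] and so normalises [VU U]. With [bs_trans], the sum then depends
    only on the blocks of [U]. *)
Lemma toggle_sum_conj z U : z \in VU U -> toggle_sum (z @: U) = toggle_sum U.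
Proof.
move=> VUz; have /fixingP[Vz _] := VUz.
rewrite /toggle_sum (reindex_inj (mulIg z)) /=.
rewrite (eq_bigl (mem V)) => [|y]; last by rewrite /= groupMr.
apply: eq_bigr => y Vy; rewrite /toggle_term conjgM imset_permJ /VU (lab_imsetV FVW _ Vz).
have [gU /= | //] := eqVneq; rewrite orbit_signJ.
set g' := g ^ y in gU *.
have Fg': g' \in F by rewrite groupJ // (subsetP sVF).
have g'VU: U = g'^-1 @: U by rewrite -[in RHS]gU imset_permK.
have E (a b : {perm T}) : (a ^ b)^-1 = a^-1 * (b^-1 ^ a^-1 * b).
  by rewrite -conjVg !conjgE invgK !mulgA mulVg mul1g.
have VUw : z^-1 ^ g'^-1 * z \in VU U.
  by rewrite groupM // {1}/VU g'VU (fixing_conj FVW) groupV.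
have EVU : (h * (g' ^ z)^-1 \in VU U) = (h * g'^-1 \in VU U) by rewrite E mulgA groupMr.
by congr (if _ then _ else _).
Qed.

Variable u0 : T.
Let O := porbit h u0.
Hypothesis ptO : ptrans lab W O.

Lemma lab_toggle k g' x : h = k * g' -> k \in V -> g' \in F -> lab (h x) = lab (g' x).
Proof.
by move=> -> Vk Fg'; rewrite permM; apply: (bs_lab FVW Fg'); apply: bs_labV FVW _ _ Vk.
Qed.

(** Put [g' = g ^ y] and [k = h * g'^-1]. The conditions for [U] and for [U :|: O] are equivalent:
    each forces [k] to fix [O] pointwise, so [g'] and [h] agree on [O]. Then [O] is one further
    [g']-orbit, which changes the sign. *)
Lemma toggle_termU y U : y \in V -> [disjoint lab @: U & lab @: O] ->
  toggle_term y (U :|: O) = (- toggle_term y U)%R.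
Proof.
move=> Vy disUO; set g' := g ^ y; set k := h * g'^-1.
have Dh: h = k * g' by rewrite mulgKV.
have Fg': g' \in F by rewrite groupJ // (subsetP sVF).
have UO' x: x \in U -> x \in O -> False.
  move=> Ux Ox; move/pred0P/(_ (lab x)): disUO => /=.
  by rewrite !imset_f.
have U'u0: u0 \notin U by apply/negP=> /UO'; apply; apply: porbit_id.
have /ptransP[_ injO] := ptO.
have hO : h @: O = O by apply: imset_porbit.
have disOx x: x \in O -> lab x \notin lab @: U.
  move=> Ox; apply/negP=> Ux; move/pred0P/(_ (lab x)): disUO => /=.
  by rewrite Ux imset_f.
have fwd: g' @: U = U -> k \in VU U -> {in O, g' =1 h}.
  by move=> g'U /fixingP[_ Ck] x Ox; rewrite Dh permM Ck ?disOx.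
rewrite /toggle_term -/g' -/k.
have <-: (g' @: U == U) && (k \in VU U) = (g' @: (U :|: O) == U :|: O) && (k \in VU (U :|: O)).
  apply/andP/andP=> [[/eqP g'U VUk] | [/eqP g'UO VUk]].
    split; last by apply: subsetP VUk; rewrite fixing_sub // imsetS // subsetUl.
    rewrite imsetU g'U; apply/eqP; congr (_ :|: _); rewrite -[RHS]hO.
    exact: eq_in_imset (fwd g'U VUk).
  have /fixingP[Vk Ck] := VUk.
  have g'O: g' @: O = O.
    apply/eqP; rewrite eqEcard card_imset ?leqnn ?andbT; last exact: perm_inj.
    apply/subsetP=> _ /imsetP[x Ox ->].
    have: g' x \in U :|: O by rewrite -g'UO imset_f // inE Ox orbT.
    have Ohx: h x \in O by rewrite -hO imset_f.
    case/setUP=> // Ug'x; case/negP: (disOx _ Ohx).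
    by rewrite (lab_toggle _ Dh) // imset_f.
  split.
    rewrite eqEcard card_imset ?leqnn ?andbT; last exact: perm_inj.
    apply/subsetP=> _ /imsetP[x Ux ->].
    have: g' x \in U :|: O by rewrite -g'UO imset_f // inE Ux.
    case/setUP=> //; rewrite -g'O => /imsetP[x' Ox' /perm_inj Exx'].
    by case: (@UO' x) => //; rewrite Exx'.
  have kO x: x \in O -> k x = x.
    move=> Ox; apply: injO => //; last exact: bs_labV FVW _ _ Vk.
    have: h x \in g' @: O by rewrite g'O -hO imset_f.
    by case/imsetP=> z Oz Ez; rewrite /k permM Ez permK.
  apply/fixingP; split=> // y' D'y'.
  have [/imsetP[x Ox Exy] | O'y'] := boolP (lab y' \in lab @: O).
    exact: bs_free FVW _ _ _ Vk (esym Exy) (kO x Ox).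
  by apply: Ck; rewrite imsetU inE negb_or D'y'.
case: ifP => [/andP[/eqP g'U VUk] | _]; last by rewrite oppr0.
have <-: porbit g' u0 = O by apply: eq_porbit; apply: fwd.
by rewrite orbit_signU.
Qed.

Lemma toggle_sumU U : [disjoint lab @: U & lab @: O] ->
  toggle_sum (U :|: O) = (- toggle_sum U)%R.
Proof.
by move=> dUO; rewrite -sumrN; apply: eq_bigr => y Vy; apply: toggle_termU.
Qed.

(** A nonzero term makes the blocks of [U] stable under [h], as [h] and [g ^ y] move blocks alike;
    sharing one block with the orbit [O], [U] would then meet all blocks of [O]. *)
Lemma toggle_sum0 U : ~~ [disjoint lab @: U & lab @: O] -> ~~ (lab @: O \subset lab @: U) ->
  toggle_sum U = 0%R.
Proof.
move=> /pred0Pn[i /= /andP[Di /imsetP[x Ox Ei]]] nsOU; apply: big1 => y Vy.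
rewrite /toggle_term; case: ifP => // /andP[/eqP g'U /fixingP[Vk _]].
case/negP: nsOU; apply/subsetP=> _ /imsetP[z Oz ->].
have Fg': g ^ y \in F by rewrite groupJ // (subsetP sVF).
have Dh: h = h * (g ^ y)^-1 * g ^ y by rewrite mulgKV.
have /porbitP[j ->]: z \in porbit h x.
  by have /eqP <-: porbit h u0 == porbit h x by rewrite eq_porbit_mem porbit_sym.
elim: j => [|j /imsetP[u Uu Ezu]]; first by rewrite perm1 -Ei.
rewrite expgSr permM (bs_lab FVW Fh Ezu) (lab_toggle _ Dh) //.
by rewrite imset_f // -g'U imset_f.
Qed.

(** The transversals of [D] number [#|fixing lab V D|] if there are any, and share their
    [toggle_sum]; [f D] is this common value, or 0 if there are none. *)
Let f (D : {set I}) : algC :=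
  (\sum_(U | ptrans lab W U && (lab @: U == D)) #|fixing lab V D|%:R^-1 * toggle_sum U)%R.

Lemma card_transversals U : ptrans lab W U ->
  #|[set U' | ptrans lab W U' & lab @: U' == lab @: U]| = #|VU U|.
Proof.
move=> ptU; have /ptransP[_ injU] := ptU.
have <-: #|[set (v : {perm T}) @: U | v in VU U]| = #|VU U|.
  rewrite card_in_imset // => v w VUv VUw Evw; apply/eqP; rewrite eq_mulgV1; apply/eqP.
  apply: (fixing_free FVW _ _ injU); first by rewrite groupM ?groupV.
  by rewrite imset_permM Evw imset_permK.
congr #|pred_of_set _|; apply/setP=> U'; rewrite inE.
apply/andP/imsetP=> [[ptU' /eqP E] | [v VUv ->]].
  by have [v VUv <-] := bs_trans FVW ptU ptU' (esym E); exists v.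
have /fixingP[Vv _] := VUv.
by rewrite (lab_imsetV FVW) // eqxx (ptrans_imset FVW) ?(subsetP sVF).
Qed.

Lemma toggle_f U : ptrans lab W U -> f (lab @: U) = toggle_sum U.
Proof.
move=> ptU; rewrite /f (eq_bigr (fun=> #|VU U|%:R^-1 * toggle_sum U)%R); last first.
  move=> U' /andP[ptU' /eqP E]; have [v VUv <-] := bs_trans FVW ptU ptU' (esym E).
  by rewrite toggle_sum_conj.
rewrite (eq_bigl (mem [set U' | ptrans lab W U' & lab @: U' == lab @: U])); last first.
  by move=> U'; rewrite /= inE.
by rewrite sumr_const card_transversals // -[LHS]mulr_natl mulVKf // neq0CG.
Qed.

(** Group the terms by the set [D] of blocks met, and let [E] be the blocks of [O]. Sets meeting [E]
    without containing it contribute 0, and each [D] disjoint from [E] cancels against [D :|: E]. *)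
Lemma toggle_total :
  (\sum_(U | ptrans lab W U) #|VU U|%:R^-1 * toggle_sum U = 0)%R.
Proof.
rewrite (partition_big (fun U : {set T} => lab @: U) predT) //=.
rewrite (eq_bigr f); last by move=> D _; apply: eq_bigr => U /andP[_ /eqP <-].
set E := lab @: O.
rewrite (bigID (fun D : {set I} => [disjoint D & E])) /=.
rewrite [X in (_ + X)%R](bigID (fun D : {set I} => E \subset D)) /= [X in (_ + (_ + X))%R]big1 ?addr0; last first.
  move=> D /andP[nd ns]; apply: big1 => U /andP[ptU /eqP DU].
  by rewrite toggle_sum0 ?mulr0 // DU.
rewrite [X in (_ + X)%R](reindex_onto (fun D => D :|: E) (fun D => D :\: E)) /=; last first.
  move=> D /andP[_ sED]; apply/setP=> i; rewrite !inE.
  by have [/(subsetP sED)-> | ] := boolP (i \in E); rewrite ?orbF.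
rewrite [X in (_ + X)%R](eq_bigl (fun D => [disjoint D & E])) /=; last first.
  move=> D; rewrite subsetUr andbT setDUl setDv setU0.
  have -> /=: ~~ [disjoint D :|: E & E].
    apply/pred0Pn; exists (lab u0); rewrite /= inE.
    by rewrite imset_f ?orbT // porbit_id.
  by apply/eqP/idP=> /setDidPl.
rewrite -big_split /= big1 // => D dDE.
have [/existsP[U /andP[ptU /eqP DU]] | nex] := boolP [exists U, ptrans lab W U && (lab @: U == D)].
  have ptUO : ptrans lab W (U :|: O).
    have [/ptransP[UW injU] /ptransP[OW injO]] := (ptU, ptO).
    apply/ptransP; split=> [x /setUP[/UW|/OW] // | x y].
    have dis a b: a \in U -> b \in O -> lab a = lab b -> False.
      move=> Ua Ob Eab; move/pred0P/(_ (lab a)): dDE => /=.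
      by rewrite -DU imset_f // Eab imset_f.
    move=> /setUP[Ux|Ox] /setUP[Uy|Oy] Exy; first exact: injU.
    - by case: (dis x y).
    - by case: (dis y x).
    - exact: injO.
  rewrite -DU /E -imsetU !toggle_f // toggle_sumU ?subrr //.
  by rewrite DU.
rewrite /f !big1 ?addr0 // => U.
  case/andP=> ptU DU; case/existsP: nex; exists (U :&: lab @^-1: D).
  have /ptransP[UW injU] := ptU.
  apply/andP; split.
    by apply/ptransP; split=> [x /setIP[/UW] | x y /setIP[Ux _] /setIP[Uy _]] //; apply: injU.
  apply/eqP/setP=> i; apply/imsetP/idP=> [[x /setIP[_]] | Di]; first by rewrite inE => Dx ->.
  have: i \in lab @: U by rewrite (eqP DU) inE Di.
  by case/imsetP=> x Ux Ei; exists x; rewrite // inE Ux inE -Ei.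
by move=> DU; case/existsP: nex; exists U.
Qed.

End ToggleOrbit.

(** * Averages and orbit signs as virtual characters *)

Section AverageCharacter.

Local Open Scope ring_scope.

Lemma sum_sdprod (gT : finGroupType) (K H M : {group gT}) (f : gT -> algC) :
  (K ><| H = M)%g -> \sum_(m in M) f m = \sum_(h in H) \sum_(k in K) f (k * h)%g.
Proof.
case/sdprodP=> _ defM _ tiKH; rewrite pair_big /=.
rewrite -defM (_ : (K * H)%g = [set (hk.2 * hk.1)%g | hk in setX H K]); last first.
  apply/setP=> x; apply/mulsgP/imsetP=> [[k h Kk Hh ->] | [[h k] /setXP[Hh Kk] ->]].
    by exists (h, k); rewrite ?inE //= Hh.
  by exists k h.
rewrite big_imset /=; first by apply: eq_bigl => -[h k]; rewrite inE.
move=> [h k] [h' k'] /setXP[Hh Kk] /setXP[Hh' Kk'] /= E.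
have Ek: (k'^-1 * k = h' * h^-1)%g by rewrite -(mulgK h k) E !mulgA mulVg mul1g.
have: (k'^-1 * k)%g \in (K :&: H)%g.
  by rewrite inE {2}Ek !groupM ?groupV.
rewrite tiKH => /set1P k1; move/eqP: (k1); rewrite Ek -eq_mulgV1 => /eqP <-.
by move/eqP: k1; rewrite -eq_mulVg1 => /eqP->.
Qed.

(** Averaging over [K] is adjoint to inflation along [M -> H]: the product of [phi] with ['chi_i] is
    that of ['Res[M] xi] with an inflated character, an integer. *)
Lemma average_vchar (gT : finGroupType) (G K H M : {group gT}) (xi : 'CF(G)) :
  (K ><| H = M)%g -> M \subset G -> xi \in 'Z[irr G] ->
  exists2 phi : 'CF(H), phi \in 'Z[irr H] &
    {in H, forall g, phi g = #|K|%:R^-1 * \sum_(v in K) xi (v * g)%g}.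
Proof.
move=> defM sMG Zxi; have [_ _ nKH _] := sdprodP defM.
have [/andP[sKM _] sHM _ _ _] := sdprod_context defM.
pose a g := if g \in H then #|K|%:R^-1 * \sum_(v in K) xi (v * g)%g else 0.
have aJ: {in H &, forall g y, a (g ^ y)%g = a g}.
  move=> g y Hg Hy; rewrite /a groupJr // Hg; congr (_ * _).
  rewrite (reindex_inj (conjg_inj y)) /=; apply: eq_big => v.
    by rewrite memJ_norm // (subsetP nKH).
  move=> _; rewrite -conjMg cfunJ // (subsetP sMG) // (subsetP sHM) //.
have a0 g: g \notin H -> a g = 0 by rewrite /a => /negPf->.
have aP: is_class_fun <<H>> (finfun a) by rewrite genGid; apply: intro_class_fun.
pose phi : 'CF(H) := Cfun 0 aP.
have phiE g: phi g = a g by rewrite cfunE.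
exists phi; last by move=> g Hg; rewrite phiE /a Hg.
rewrite [phi]cfun_sum_cfdot rpred_sum // => i _.
rewrite scale_zchar ?irr_vchar //.
suff ->: '[phi, 'chi_i] = '['Res[M] xi, cfSdprod defM 'chi_i].
  by rewrite Cint_cfdot_vchar ?cfRes_vchar // char_vchar // cfSdprod_char irr_char.
rewrite !cfdotE (sum_sdprod _ defM) -(sdprod_card defM) natrM invfM -[RHS]mulrA [RHS]mulrCA.
congr (_ * _); rewrite mulr_sumr; apply: eq_bigr => g Hg.
rewrite phiE /a Hg -mulrA; congr (_ * _); rewrite mulr_suml; apply: eq_bigr => v Kv.
have Mvg: (v * g)%g \in M by apply: groupM; [apply: (subsetP sKM) | apply: (subsetP sHM)].
by rewrite cfSdprodE // cfResE.
Qed.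

End AverageCharacter.

Section SignCharacter.

Variable T : finType.
Implicit Types (U : {set T}) (g : {perm T}) (L : {group {perm T}}).

(** The parity of a permutation of [U] is that of [#|U|] minus its number of cycles. Extending by
    the identity adds one cycle for each point outside [U]. *)
Lemma orbit_sign_odd U g : g @: U = U ->
  orbit_sign U g = ((-1) ^+ #|U| * (-1) ^+ odd_perm (restr_perm U g))%R.
Proof.
move=> gU; set q := restr_perm U g.
have qU: {in U, q =1 g} by move=> x Ux; apply: restr_permE => //; apply/astabs_permP.
have qU' x: x \notin U -> q x = x by apply: out_perm (restr_perm_on _ _).
have porbU: {in U, porbit q =1 porbit g}.
  by move=> u Uu; apply: eq_porbit => y gy; apply: qU; apply: subsetP gy; apply: porbit_sub.
have porbU' x: x \notin U -> porbit q x = [set x].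
  move=> U'x; apply/setP=> y; rewrite inE; apply/porbitP/eqP=> [[i ->] | ->].
    by apply: permX_fix; apply: qU'.
  by exists 0; rewrite perm1.
have defO: porbits q = [set porbit g u | u in U] :|: [set [set x] | x in ~: U].
  apply/setP=> O; rewrite inE; apply/imsetP/orP=> [[x _ ->] | [] /imsetP[x Ux ->]].
  - have [Ux | U'x] := boolP (x \in U); [left | right]; apply/imsetP; exists x; rewrite ?inE //.
    + exact: porbU.
    + exact: porbU'.
  - by exists x; rewrite ?porbU.
  - by exists x; rewrite ?porbU' // -in_setC.
have dis: [disjoint [set porbit g u | u in U] & [set [set x] | x in ~: U]].
  apply/pred0P=> O /=; apply/andP=> [[/imsetP[u Uu ->] /imsetP[x U'x E]]].
  have: u \in [set x] by rewrite -E porbit_id.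
  by move=> /set1P Eux; move: U'x; rewrite -Eux inE Uu.
have cardO: #|porbits q| = (#|[set porbit g u | u in U]| + (#|T| - #|U|))%N.
  rewrite defO cardsU disjoint_setI0 // cards0 subn0; congr (_ + _)%N.
  by rewrite card_imset -?(cardsC U) ?addKn //; apply: set1_inj.
rewrite /orbit_sign /odd_perm cardO -signr_odd -[in RHS](signr_odd _ #|U|) -signr_addb.
congr (_ ^+ _)%R; congr nat_of_bool; rewrite oddD oddB ?max_card //.
by case: (odd #|T|); case: (odd #|U|); case: (odd _).
Qed.

Lemma orbit_sign_vchar U L : L \subset 'N(U | 'P) ->
  exists2 phi : 'CF(L), phi \in 'Z[irr L] & {in L, forall g, phi g = orbit_sign U g}.
Proof.
move=> nUL; pose r g : 'M[algC]_1 := (((-1) ^+ odd_perm (restr_perm U g))%:M)%R.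
have reprL : mx_repr L r.
  split=> [|x y Lx Ly]; first by rewrite /r morph1 odd_perm1.
  by rewrite /r morphM ?(subsetP nUL) // odd_permM signr_addb scalar_mxM.
exists (((-1) ^+ #|U|) *: cfRepr (MxRepresentation reprL))%R.
  by rewrite scale_zchar ?char_vchar ?cfRepr_char // rpredX ?rpredN ?rpred1.
move=> g Lg; rewrite cfunE cfunE Lg mulr1n /= mxtrace_scalar mulr1n orbit_sign_odd //.
exact/astabs_permP/(subsetP nUL).
Qed.

End SignCharacter.

(** * The signed average formula *)

Section SignedAverage.

Variables (T I : finType) (lab : T -> I) (F V : {group {perm T}}) (W : {set I}).
Implicit Types (U : {set T}) (D : {set I}) (g h y v : {perm T}).
Hypothesis FVW : block_setting lab F V W.
Variable xi : 'CF(F).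

Let sVF := block_sub FVW.
Let memF v : v \in V -> v \in F. Proof. exact: (subsetP sVF). Qed.

Definition signed_average U g : algC :=
  (orbit_sign U g * (#|fixing lab V (lab @: U)|%:R^-1 *
     \sum_(v in fixing lab V (lab @: U)) xi (v * g)%g))%R.

Lemma fixing_subF D v : v \in fixing lab V D -> v \in F.
Proof. by case/fixingP=> Vv _; apply: memF. Qed.

Lemma signed_averageJ U g y : g \in F -> y \in F ->
  signed_average (y @: U) (g ^ y) = signed_average U g.
Proof.
move=> Fg Fy; have fJ := fixing_conj FVW _ _ Fy.
have cardJ: #|fixing lab V (lab @: (y @: U))| = #|fixing lab V (lab @: U)|.
  rewrite -[RHS](cardJg _ y); apply: eq_card => v.
  by rewrite mem_conjg -[in LHS](conjgKV y v) fJ.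
rewrite /signed_average orbit_signJ cardJ; congr (_ * (_ * _))%R.
rewrite (reindex_inj (conjg_inj y)) /=; apply: eq_big => v; first exact: fJ.
by rewrite fJ => Vv; rewrite -conjMg cfunJ // groupM // (fixing_subF Vv).
Qed.

Lemma signed_average_toggle U g : g \in F ->
  ((if g @: U == U then signed_average U g else 0) =
   \sum_(h in F) #|fixing lab V (lab @: U)|%:R^-1 *
      ((if (g @: U == U) && ((h * g^-1)%g \in fixing lab V (lab @: U))
        then orbit_sign U g else 0) * xi h))%R.
Proof.
move=> Fg; case: eqVneq => [gU | _] /=; last first.
  by rewrite big1 // => h _; rewrite mul0r mulr0.
rewrite /signed_average mulrCA mulr_sumr mulr_sumr [RHS](reindex_inj (mulIg g)) /=.
rewrite [RHS]big_mkcond [LHS]big_mkcond /=; apply: eq_bigr => v _.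
rewrite mulgK groupMr //; case: ifP => Vv; last by rewrite mul0r mulr0; case: ifP.
by rewrite (fixing_subF Vv).
Qed.

(* The term of the empty [U] is [xi g]. *)
Lemma sum_signed_average g : g \in F ->
    (forall h, h \in F -> (forall U, ptrans lab W U -> h @: U = U -> U = set0) -> xi h = 0%R) ->
  (\sum_(U | ptrans lab W U && (g @: U == U)) signed_average U g = 0)%R.
Proof.
move=> Fg xi0; pose Psi g := (\sum_(U | ptrans lab W U && (g @: U == U)) signed_average U g)%R.
have PsiJ y: y \in F -> Psi (g ^ y) = Psi g.
  move=> Fy; rewrite /Psi (reindex_inj (imset_inj (@perm_inj _ y))) /=.
  apply: eq_big => U.
    rewrite imset_permJ; congr (_ && _); apply/idP/idP; last exact: ptrans_imset FVW _ _ Fy.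
    by move/(ptrans_imset FVW (groupVr Fy)); rewrite imset_permK.
  by move=> _; apply: signed_averageJ.
(* The sum is a class function of [g], so [#|V|] times it is the sum over the conjugates [g ^ y]
   with [y] in [V]; this is what produces the [toggle_sum] coefficients of each [xi h]. *)
apply/eqP; rewrite -/(Psi g) -(mulrI_eq0 _ (mulfI (neq0CG V))); apply/eqP.
rewrite mulr_natl -sumr_const (eq_bigr (fun y => Psi (g ^ y))); last first.
  by move=> y Vy; rewrite PsiJ // memF.
rewrite /Psi; under eq_bigr => y Vy.
  rewrite big_mkcondr /=; under eq_bigr => U _.
    rewrite signed_average_toggle; last by rewrite groupJ // memF.
    over.
  rewrite exchange_big /=; over.
rewrite exchange_big /= big1 // => h Fh.
(* Either [h] stabilises a nonempty partial transversal, and an [h]-orbit in it makes the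
   coefficient of [xi h] vanish, or [xi h = 0] by hypothesis. *)
have [/existsP[U /and3P[ptU /eqP hU /set0Pn[u Uu]]] | nex] :=
    boolP [exists U : {set T}, [&& ptrans lab W U, h @: U == U & U != set0]].
  have ptO : ptrans lab W (porbit h u).
    have /ptransP[UW injU] := ptU; have /subsetP sOU := porbit_sub hU Uu.
    by apply/ptransP; split=> [x /sOU/UW | x y /sOU Ux /sOU Uy] //; apply: injU.
  have := toggle_total FVW Fg Fh ptO; rewrite exchange_big /= => /(congr1 ( *%R^~ (xi h))).
  rewrite mul0r mulr_suml => E; rewrite -[RHS]E.
  by apply: eq_bigr => U' _; rewrite mulr_sumr mulr_suml; apply: eq_bigr => y _; rewrite mulrA.
have -> : xi h = 0%R.
  apply: xi0 => // U ptU hU; apply/eqP; apply: contraNT nex => nzU.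
  by apply/existsP; exists U; rewrite ptU hU eqxx.
by apply: big1 => y _; apply: big1 => U _; rewrite !mulr0.
Qed.

Definition orb U := [set (y : {perm T}) @: U | y in F].

(** The sets in the orbit of [U] correspond to the cosets of its stabiliser, and equivariance of [f]
    turns the terms of the induced character into values [f U' g]. *)
Lemma Ind_stabilizer (f : {set T} -> {perm T} -> algC) U (phi : 'CF('N_F(U | 'P))) g :
    (forall U' h y, h \in F -> y \in F -> f (y @: U') (h ^ y) = f U' h) ->
    {in 'N_F(U | 'P), phi =1 f U} -> g \in F ->
  ('Ind[F] phi g = \sum_(U' in orb U | g @: U' == U') f U' g)%R.
Proof.
move=> fJ phiE Fg; set L := 'N_F(U | 'P)%G; rewrite cfIndE ?subsetIl //.
pose G (U' : {set T}) := (if g @: U' == U' then f U' g else 0)%R.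
have phiG y: y \in F -> phi (g ^ y^-1) = G (y @: U).
  move=> Fy; rewrite /G; have := imset_permJ (g ^ y^-1) y U; rewrite conjgKV => ->.
  have Fgy: g ^ y^-1 \in F by rewrite groupJ ?groupV.
  case: eqVneq => [gU | ngU]; last first.
    by rewrite cfun0 // inE Fgy; apply: contra ngU => /astabs_permP->.
  have := fJ U _ y Fgy Fy; rewrite conjgKV => ->.
  by apply: phiE; rewrite inE Fgy; apply/astabs_permP.
have cardL y: y \in F -> #|[set z in F | z @: U == y @: U]| = #|L|.
  move=> Fy; rewrite -(card_rcoset L y); apply: eq_card => z.
  rewrite mem_rcoset inE [RHS]inE groupMr ?groupV //; congr (_ && _).
  apply/eqP/astabs_permP; rewrite imset_permM; first by move=> ->; apply: imset_permK.
  move=> E.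
  by rewrite -{2}E imset_permKV.
rewrite (reindex_inj invg_inj) /= (eq_bigl (mem F)) => [|y]; last by rewrite /= groupV.
rewrite (eq_bigr (fun y : {perm T} => G (y @: U))) //.
rewrite (partition_big_imset (fun y : {perm T} => y @: U)) /= mulr_sumr [RHS]big_mkcondr.
apply: eq_bigr => _ /imsetP[y Fy ->].
rewrite (eq_bigr (fun=> G (y @: U))) => [|z /andP[_ /eqP->]] //.
rewrite (eq_bigl (mem [set z in F | z @: U == y @: U])) => [|z]; last by rewrite /= inE.
by rewrite sumr_const cardL // -[X in (_ * X)%R]mulr_natl mulKf // neq0CG.
Qed.

End SignedAverage.

Lemma ind_span_sub (gT : finGroupType) (Fam Fam' : {group gT} -> Prop)
    (G : {group gT}) (f : 'CF(G)) :
  (forall L : {group gT}, L \subset G -> Fam L -> Fam' L) ->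
  ind_span Fam f -> ind_span Fam' f.
Proof.
move=> sFF'; apply: ind_span_trans => L phi sLG FL Zphi.
by apply: ind_span_gen => //; apply: sFF'.
Qed.

(** * Induction from stabilisers of partial transversals *)

Section VanishingInduction.

Variables (T I : finType) (lab : T -> I).
Implicit Types (F V L : {group {perm T}}) (W : {set I}) (U : {set T}).

Definition stabilizes_ptrans W c L : Prop :=
  exists U, [/\ ptrans lab W U, L \subset 'N(U | 'P) & c <= #|U|].

Section Stabilizer.

Variables (F V : {group {perm T}}) (W : {set I}) (U : {set T}).
Hypotheses (FVW : block_setting lab F V W) (ptU : ptrans lab W U).

Let L := 'N_F(U | 'P)%G.
Let D := lab @: U.
Let sVF := block_sub FVW.

Lemma stabilizer_lab g x : g \in L -> (lab (g x) \in D) = (lab x \in D).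
Proof.
have sub h y: h \in L -> lab y \in D -> lab (h y) \in D.
  case/setIP=> Fh /astabs_permP hU /imsetP[u Uu Eyu].
  by rewrite (bs_lab FVW Fh Eyu) imset_f // -hU imset_f.
move=> Lg; apply/idP/idP => [ /(sub g^-1) | ]; last exact: sub.
by rewrite groupV permK; apply.
Qed.

(** This drives the induction on [c]: once [U] is stabilised, the blocks of [W] not met by [U] form
    a smaller setting. The elements of [V] supported there fix [U] pointwise and so lie in [L]. *)
Lemma block_setting_stabilizer : block_setting lab L (fixing lab V (W :\: D)) (W :\: D).
Proof.
have memF v : v \in V -> v \in F by apply: (subsetP sVF).
have sLF g : g \in L -> g \in F by case/setIP.
have LW g x : g \in L -> (lab (g x) \in W :\: D) = (lab x \in W :\: D).
  move=> Lg; rewrite !inE stabilizer_lab //; congr (_ && _).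
  apply/idP/idP => [Wgx | ]; last exact: bs_W FVW _ _ (sLF g Lg).
  by have := bs_W FVW (groupVr (sLF g Lg)) Wgx; rewrite permK.
split.
- apply/andP; split.
    apply/subsetP=> v /fixingP[Vv Cv]; rewrite inE memF //.
    apply/astabs_permP/eqP; rewrite eqEcard card_imset ?leqnn ?andbT; last exact: perm_inj.
    apply/subsetP=> _ /imsetP[x Ux ->]; rewrite Cv // inE negb_and negbK.
    by rewrite /D imset_f.
  apply/subsetP=> g Lg; rewrite inE; apply/subsetP=> _ /imsetP[v /fixingP[Vv Cv] ->].
  apply/fixingP; split=> [|x Wx]; first by rewrite (block_memJ FVW) // sLF.
  by rewrite -(permKV g x) permJ Cv // LW ?groupV.
- by move=> g x y /sLF Fg; apply: (bs_lab FVW).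
- by move=> g x Lg; rewrite LW.
- by move=> v x /fixingP[Vv _]; apply: (bs_labV FVW).
- by move=> v x y /fixingP[Vv _]; apply: (bs_free FVW).
move=> U1 U2 pt1 pt2 E12.
have ptW A: ptrans lab (W :\: D) A -> ptrans lab W A.
  by case/andP=> sA injA; rewrite /ptrans injA (subset_trans sA) // subsetDl.
have [v /fixingP[Vv Cv] vU] := bs_trans FVW (ptW _ pt1) (ptW _ pt2) E12.
exists v => //; apply/fixingP; split=> //; apply/fixingP; split=> // x Wx; apply: Cv.
by apply: contra Wx; have /andP[/subsetP s1 _] := pt1; apply: s1.
Qed.

Lemma fixing_sdprod : fixing lab V D ><| L = (fixing lab V D <*> L)%G.
Proof.
apply: sdprodEY.
  apply/subsetP=> g Lg; rewrite inE; apply/subsetP=> _ /imsetP[v /fixingP[Vv Cv] ->].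
  have /setIP[Fg _] := Lg.
  apply/fixingP; split=> [|x Dx]; first by rewrite (block_memJ FVW).
  by rewrite -(permKV g x) permJ Cv // stabilizer_lab ?groupV.
apply/trivgP/subsetP=> v /setIP[VDv /setIP[_ /astabs_permP vU]]; apply/set1P.
by apply: fixing_free FVW _ _ VDv vU _; have /ptransP[] := ptU.
Qed.

End Stabilizer.

(** The signed average formula writes [xi] as minus a sum of characters induced from stabilisers of
    nonempty [U]. If [#|U| < c], induction with [c - #|U|] on the remaining blocks yields some [U1],
    and [U :|: U1] is large enough. *)
Theorem vanishing_ind_span c F V W (xi : 'CF(F)) :
    block_setting lab F V W -> xi \in 'Z[irr F] ->
    (forall g, g \in F ->
       (forall U, ptrans lab W U -> g @: U = U -> #|U| < c) -> xi g = 0%R) ->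
  ind_span (stabilizes_ptrans W c) xi.
Proof.
have [m] := ubnP c; elim: m => // m IH in c F V W xi * => lt_cm FVW Zxi xi0.
have pt0 : ptrans lab W set0 by rewrite /ptrans imset0 sub0set !cards0 eqxx.
have [c0 | c_gt0] := posnP c.
  rewrite -(cfInd_id xi); apply: ind_span_gen => //; exists set0; split=> //; last by rewrite c0.
  by apply/subsetP=> g _; apply/astabs_permP; rewrite imset0.
have xi_nofix h : h \in F -> (forall U, ptrans lab W U -> h @: U = U -> U = set0) -> xi h = 0%R.
  by move=> Fh h0; apply: xi0 => // U ptU hU; rewrite (h0 U) // cards0.
have orbP U : ptrans lab W U -> exists2 Th : 'CF(F),
    (U != set0 -> ind_span (stabilizes_ptrans W c) Th) &
    {in F, forall g, Th g =
      \sum_(U' in orb F U | g @: U' == U') signed_average lab V xi U' g}%R.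
  move=> ptU; set L := 'N_F(U | 'P)%G; set D := lab @: U.
  have sMF : (fixing lab V D <*> L)%G \subset F.
    rewrite join_subG subsetIl andbT; apply/subsetP=> v.
    exact: (fixing_subF FVW).
  have [ph1 Zph1 ph1E] := average_vchar (fixing_sdprod FVW ptU) sMF Zxi.
  have [ph2 Zph2 ph2E] := orbit_sign_vchar (subsetIr F 'N(U | 'P)).
  have phE : {in L, (ph2 * ph1)%R =1 signed_average lab V xi U}.
    by move=> g Lg; rewrite cfunE ph1E ?ph2E.
  have Zph : (ph2 * ph1)%R \in 'Z[irr L] by rewrite mul_vchar.
  exists ('Ind[F] (ph2 * ph1))%R; last first.
    move=> g Fg; apply: Ind_stabilizer => //.
    exact: signed_averageJ FVW _.
  move=> nzU; apply: ind_span_Ind; first exact: subsetIl.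
  have [le_cU | lt_Uc] := leqP c #|U|.
    rewrite -(cfInd_id (ph2 * ph1)%R); apply: ind_span_gen => //.
    by exists U; split=> //; apply: subsetIr.
  have ltc : c - #|U| < m.
    have U0 : 0 < #|U| by rewrite card_gt0.
    by rewrite -ltnS (leq_trans _ lt_cm) // !ltnS ltn_subrL // c_gt0 U0.
  have cardD : #|D| = #|U| by have /andP[_ /eqP] := ptU.
  have LVD := block_setting_stabilizer U FVW.
  apply: ind_span_sub (IH _ _ _ _ _ ltc LVD Zph _) => [L1 sL1L [U1 [pt1 nU1 le1]] | g Lg gU'].
    have dis x y: x \in U -> y \in U1 -> lab x = lab y -> False.
      move=> Ux Uy Exy; have /ptransP[/(_ y Uy)] := pt1.
      by rewrite inE -Exy imset_f.
    exists (U :|: U1); split.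
    - have [/ptransP[UW injU] /ptransP[U1W inj1]] := (ptU, pt1).
      apply/ptransP; split=> [x /setUP[/UW | /U1W/setDP[]] // | x y].
      case/setUP=> Ux /setUP[] Uy Exy; [exact: injU|by case: (dis x y)|by case: (dis y x)|exact: inj1].
    - apply/subsetP=> g L1g; apply/astabs_permP; rewrite imsetU; congr (_ :|: _).
        by have /setIP[_ /astabs_permP] := subsetP sL1L g L1g.
      exact/astabs_permP/(subsetP nU1).
    - rewrite cardsU (_ : U :&: U1 = set0) ?cards0 ?subn0; first by rewrite -leq_subLR.
      by apply/setP=> x; rewrite !inE; apply/andP=> [[Ux U1x]]; apply: (dis x x).
  (* For [v] supported on the blocks of [U], [v * g] and [g] agree elsewhere. A partial transversal
     stable under [v * g] has at most [#|U|] points in these blocks, and its other points form a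
     [g]-stable set of size less than [c - #|U|]. So every summand vanishes. *)
  have /setIP[Fg /astabs_permP gU] := Lg.
  rewrite phE // /signed_average big1 ?mulr0 // => v VDv.
  have /fixingP[Vv Cv] := VDv.
  have Fv : v \in F by apply: (fixing_subF FVW VDv).
  apply: xi0; first by rewrite groupM.
  move=> U2 pt2 vgU2; have /ptransP[U2W inj2] := pt2.
  rewrite -(cardsID (lab @^-1: D) U2) -ltn_subRL.
  have le2 : #|U2 :&: lab @^-1: D| <= #|U|.
    rewrite -cardD -(card_in_imset (f := lab)); last first.
      by move=> x y /setIP[Ux _] /setIP[Uy _]; apply: inj2.
    by apply/subset_leq_card/subsetP=> _ /imsetP[x /setIP[_ Dx] ->]; rewrite inE in Dx.
  apply: leq_trans _ (leq_sub2l c le2); apply: gU'.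
    apply/ptransP; split=> [x | x y /setDP[Ux _] /setDP[Uy _]]; last exact: inj2.
    by case/setDP=> /U2W Wx; rewrite !inE Wx andbT.
  apply/eqP; rewrite eqEcard card_imset ?leqnn ?andbT; last exact: perm_inj.
  apply/subsetP=> _ /imsetP[x /setDP[Ux Dx] ->]; rewrite inE in Dx.
  have Egx : g x = (v * g) x by rewrite permM Cv.
  by rewrite !inE (stabilizer_lab FVW x Lg) Dx Egx -vgU2 imset_f.
pose X := [set orb F U | U in [pred U : {set T} | ptrans lab W U]].
have XP (O : {set {set T}}) : exists Th : 'CF(F), O \in X ->
    (O != orb F set0 -> ind_span (stabilizes_ptrans W c) Th) /\
    {in F, forall g, Th g =
      \sum_(U' in O | g @: U' == U') signed_average lab V xi U' g}%R.
  have [/imsetP[U ptU ->] | _] := boolP (O \in X); last by exists 0%R.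
  have [Th sTh ThE] := orbP U ptU; exists Th => _; split=> // nz; apply: sTh.
  by apply: contraNneq nz => ->.
have [Th ThP] := fin_all_exists XP.
have X0 : orb F set0 \in X by apply: imset_f.
have orb0 : orb F set0 = [set set0].
  apply/setP=> U; rewrite inE; apply/imsetP/eqP=> [[y _ ->] | ->]; first exact: imset0.
  by exists 1; rewrite ?imset0.
have Exi : xi = (- \sum_(O in X :\ orb F set0) Th O)%R.
  apply/cfun_inP=> g Fg.
  have := sum_signed_average FVW Fg xi_nofix.
  rewrite (partition_big (orb F) (mem X)) /=; last by move=> U /andP[ptU _]; apply: imset_f.
  have orbX O U : O \in X -> (U \in O) = ptrans lab W U && (orb F U == O).
    case/imsetP=> U0 pt0' ->; apply/imsetP/andP=> [[y Fy ->] | [_ /eqP E]]; last first.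
      by apply/imsetP; rewrite -/(orb F U0) -E; apply/imsetP; exists 1; rewrite ?imset_perm1.
    split; first exact: ptrans_imset FVW _ _ Fy pt0'.
    apply/eqP/setP=> U'; apply/imsetP/imsetP=> [[z Fz ->] | [z Fz ->]].
      by exists (y * z); rewrite ?groupM ?imset_permM.
    by exists (y^-1 * z); rewrite ?groupM ?groupV // imset_permM imset_permK.
  rewrite (eq_bigr (fun O => Th O g)); last first.
    move=> O XO; have [_ ->] := ThP O XO; rewrite //.
    by apply: eq_bigl => U; rewrite orbX // andbAC.
  rewrite (bigD1 (orb F set0)) //= => E; rewrite cfunE sum_cfunE; apply/eqP.
  rewrite -addr_eq0 -[X in _ == X]E; apply/eqP; congr (_ + _)%R; last first.
    by apply: eq_bigl => O; rewrite !inE andbC.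
  have [_ ->] := ThP _ X0; rewrite // orb0 big_mkcondr big_set1 imset0 eqxx.
  rewrite /signed_average /orbit_sign !imset0 cards0 expr0 mul1r.
  have -> : fixing lab V set0 = 1%G.
    apply/trivGP/subsetP=> v /fixingP[_ Cv]; apply/set1P/permP=> x.
    by rewrite perm1 Cv ?inE.
  by rewrite cards1 invr1 mul1r big_set1 mul1g.
rewrite Exi; apply: ind_spanN; apply: ind_span_sum => O /setD1P[nO XO].
by have [/(_ nO)] := ThP O XO.
Qed.

End VanishingInduction.

(** * Groups acting on blocks of prime size *)

Section PrimeBlock.

Variables (T : finType) (p : nat) (S : {set T}).
Implicit Types (K : {group {perm T}}).
Hypotheses (pr_p : prime p) (cardS : #|S| = p).

Lemma prime_block_orbit K x : #|K| = p -> {in K, forall k, perm_on S k} -> x \in S ->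
  (forall k, k \in K -> k x = x) \/ orbit 'P K x = S.
Proof.
move=> oK onK Sx; have sOS: orbit 'P K x \subset S.
  by apply/subsetP=> _ /orbitP[k Kk <-]; rewrite /= apermE (perm_closed _ (onK k Kk)).
have := dvdn_orbit 'P K x; rewrite oK; have [_ dvp] := primeP pr_p.
case/dvp/orP=> /eqP oO; [left=> k Kk | right].
  have [y Ey] := cards1P (introT eqP oO).
  have /set1P kxy: k x \in [set y] by rewrite -Ey; apply: (mem_orbit 'P).
  by have /set1P xy: x \in [set y]; [rewrite -Ey orbit_refl | rewrite kxy].
by apply/eqP; rewrite eqEcard sOS cardS oO leqnn.
Qed.

Lemma prime_block_free K k x : #|K| = p -> {in K, forall k, perm_on S k} -> x \in S ->
  k \in K -> k x = x -> k = 1.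
Proof.
move=> oK onK Sx Kk kx; apply/eqP; apply: contraTT pr_p => k1.
have genK: K :=: <[k]>.
  apply/esym/eqP; rewrite eqEcard cycle_subG Kk /= oK -orderE.
  have := order_dvdG Kk; rewrite oK; have [_ dvp] := primeP pr_p.
  by case/dvp/orP=> /eqP ok; rewrite ok // -order_eq1 ok in k1 *.
have fixK: (forall g, g \in K -> g x = x) by move=> g; rewrite genK => /cycleP[i ->]; apply: permX_fix.
have: k = 1; last by move/eqP; rewrite (negPf k1).
apply/permP=> y; rewrite perm1; have [Sy | S'y] := boolP (y \in S); last first.
  exact: out_perm (onK k Kk) S'y.
case: (prime_block_orbit oK onK Sy) => [-> // | Ey].
have: x \in orbit 'P K y by rewrite Ey.
case/orbitP=> g Kg; rewrite /= apermE => Eg.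
have := fixK _ (groupVr Kg); rewrite -{1}Eg permK => ->; exact: kx.
Qed.

Lemma prime_block_trans K x y : #|K| = p -> {in K, forall k, perm_on S k} ->
  x \in S -> y \in S -> exists2 k, k \in K & k x = y.
Proof.
move=> oK onK Sx Sy; case: (prime_block_orbit oK onK Sx) => [fixK | Ex].
  have: K \subset [1].
    by apply/subsetP=> k Kk; apply/set1P; apply: prime_block_free oK onK Sx Kk (fixK k Kk).
  by move/subset_leq_card; rewrite oK cards1 leqNgt prime_gt1.
by move: Sy; rewrite -Ex => /orbitP[k Kk <-]; exists k.
Qed.

End PrimeBlock.

Section ExtendTransversal.

Variables (T I : finType) (lab : T -> I) (R : {group {perm T}}) (W : {set I}).
Hypothesis Rlab : forall g x y, g \in R -> lab x = lab y -> lab (g x) = lab (g y).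
Hypothesis RW : forall g x, g \in R -> lab x \in W -> lab (g x) \in W.

(** Take a maximal stable partial transversal containing [U0]. If it missed a block of [D], the
    orbit of the given point [x] could be added: an element of [R] returning [x] to its block fixes
    it, so the orbit has at most one point in each block. *)
Lemma extend_ptrans (U0 : {set T}) (D : {set I}) :
    ptrans lab W U0 -> R \subset 'N(U0 | 'P) -> D \subset W ->
    (forall i, i \in D -> exists2 x, lab x = i &
       forall r, r \in R -> lab (r x) = lab x -> r x = x) ->
  exists U, [/\ ptrans lab W U, R \subset 'N(U | 'P), U0 \subset U & D \subset lab @: U].
Proof.
move=> pt0 nU0 sDW fixD.
pose P U := ptrans lab W U && (R \subset 'N(U | 'P)).
have [|U maxU sU0U] := @maxset_exists _ P U0; first by rewrite /P pt0.
have /andP[ptU nUR] := maxsetp maxU; exists U; split=> //; apply/subsetP=> i Di.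
apply/negPn/negP=> nUi; have [x Exi fixx] := fixD i Di.
have /ptransP[UW injU] := ptU.
have Rinv r y: r \in R -> lab (r y) = i -> lab y = lab (r^-1 x).
  by move=> Rr Eri; rewrite -[y](permK r); apply: Rlab; rewrite ?groupV // Exi.
have dis r y: r \in R -> y \in U -> lab (r x) <> lab y.
  move=> Rr Uy E; case/negP: nUi; have: lab (r^-1 y) = i.
    by rewrite -Exi -[in RHS](permK r x); apply: Rlab; rewrite ?groupV.
  move=> <-; apply: imset_f; have /astabs_permP <- := subsetP nUR r^-1 (groupVr Rr).
  exact: imset_f.
have ptO: P (U :|: orbit 'P R x).
  apply/andP; split.
    apply/ptransP; split=> [y /setUP[/UW // | /orbitP[r Rr <-]] | y z].
      by apply: RW => //; rewrite Exi (subsetP sDW).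
    case/setUP=> [Uy | /orbitP[r Rr <-]] /setUP[Uz | /orbitP[s Rs <-]] //=; rewrite ?apermE.
    - exact: injU.
    - by move/esym/(dis s y Rs Uy).
    - by move/(dis r z Rr Uz).
    move=> E; have Rrs: r * s^-1 \in R by rewrite groupM ?groupV.
    have: (r * s^-1) x = x.
      apply: fixx => //; rewrite permM -[in RHS](permK s x).
      by apply: Rlab; rewrite ?groupV.
    by rewrite permM => /(congr1 s); rewrite permKV.
  apply/subsetP=> r Rr; apply/astabs_permP; rewrite imsetU.
  have /astabs_permP-> := subsetP nUR r Rr; congr (_ :|: _).
  apply/eqP; rewrite eqEcard card_imset ?leqnn ?andbT; last exact: perm_inj.
  apply/subsetP=> _ /imsetP[_ /orbitP[s Rs <-] ->].
  by rewrite -[r _]/(aperm _ r) /= -actM mem_orbit ?groupM.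
have := maxsetsup maxU ptO (subsetUl _ _) => EU.
by case/negP: nUi; rewrite -EU -Exi imset_f // inE orbit_refl orbT.
Qed.

End ExtendTransversal.

Lemma partn_fact_prime p : prime p -> (p`!`_p = p)%N.
Proof.
move=> pr_p; have p'fact m: m < p -> ~~ (p %| m`!).
  elim: m => [_ | m IH lt_mp]; first by rewrite fact0 dvdn1 neq_ltn prime_gt1 ?orbT.
  by rewrite factS Euclid_dvdM // negb_or gtnNdvd // IH // ltnW.
rewrite -{1}(prednK (prime_gt0 pr_p)) factS prednK ?prime_gt0 //.
rewrite partnM ?fact_gt0 ?(prime_gt0 pr_p) //.
rewrite part_pnat_id ?pnat_id //.
have p'p1: p^'.-nat p.-1`! by rewrite p'natE // p'fact // prednK ?prime_gt0.
by rewrite part_p'nat ?muln1.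
Qed.

Section BlockGroup.

Variables (T : finType) (p : nat) (S : {set T}) (X : {group {perm T}}).
Hypotheses (pr_p : prime p) (cardS : #|S| = p) (onX : {in X, forall x, perm_on S x}).
Hypothesis pX : p %| #|X|.

Lemma block_group_part : (#|X|`_p = p)%N.
Proof.
have dvX: #|X| %| p`!.
  rewrite -cardS.
  rewrite -perm.card_Sym; apply: (@cardSg _ (perm.Sym_group S) X).
  by apply/subsetP=> x Xx; rewrite inE; apply: onX.
have := partn_dvd p (fact_gt0 p) dvX; rewrite partn_fact_prime // => dvXp.
have := partn_dvd p (cardG_gt0 X) pX; rewrite part_pnat_id ?pnat_id // => dvpX.
by apply/eqP; rewrite eqn_dvd dvXp.
Qed.

Lemma block_group_trans x : x \in S -> orbit 'P X x = S.
Proof.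
move=> Sx; have [z Xz oz] := Cauchy pr_p pX.
have onZ: {in <[z]>%G, forall k, perm_on S k}.
  by move=> k /(subsetP _) Zk; apply: onX; apply: Zk; rewrite cycle_subG.
apply/eqP; rewrite eqEsubset; apply/andP; split.
  by apply/subsetP=> _ /orbitP[k Kk <-]; rewrite /= apermE (perm_closed _ (onX Kk)).
apply/subsetP=> y Sy; have [k Zk <-] := prime_block_trans pr_p cardS oz onZ Sx Sy.
by rewrite (mem_orbit 'P) // (subsetP _ _ Zk) // cycle_subG.
Qed.

(** For [q] different from [p], the Sylow p-subgroup lies in the cyclic normal subgroup [Y] and is
    characteristic there. For [q = p], [Y] has index [p] and, by transitivity on [S], is the
    stabiliser of every point of [S]; so [Y] is trivial and [X] has order [p]. *)
Lemma pcore_block_group q : prime q -> quasi_elementary q X -> #|'O_p(X)| = p.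
Proof.
move=> pr_q [Y [cycY nYX q'Y qXY]].
have sYX := normal_sub nYX; have nXY := normal_norm nYX.
have [eqp | neq] := eqVneq q p.
  rewrite {q}eqp in pr_q q'Y qXY *.
  have hallY : p^'.-Hall(X) Y.
    by rewrite /pHall sYX -card_quotient //= pnatNK q'Y.
  have pXY : p.-nat #|X : Y| by rewrite -card_quotient.
  have iXY : #|X : Y| = p.
    rewrite -[RHS]block_group_part -(Lagrange sYX) partnM ?cardG_gt0 ?indexg_gt0 //.
    by rewrite (part_p'nat q'Y) mul1n part_pnat_id.
  have cardXY : (#|Y| * p)%N = #|X| by rewrite -iXY Lagrange.
  have fixY x y : x \in S -> y \in Y -> y x = x.
    move=> Sx; have cardSt : #|'C_X[x | 'P]| = #|Y|.
      apply/eqP; rewrite -(eqn_pmul2r (prime_gt0 pr_p)) cardXY.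
      by rewrite -{1}cardS -(block_group_trans Sx) mulnC card_orbit_stab.
    have sStY: 'C_X[x | 'P]%G \subset Y.
      by rewrite (sub_normal_Hall hallY) // /pgroup ?subsetIl //= cardSt.
    have <-: 'C_X[x | 'P] = Y by apply/eqP; rewrite eqEcard sStY cardSt leqnn.
    by case/setIP=> _ /astab1P.
  have Y1 : Y :=: 1.
    apply/trivgP/subsetP=> y Yy; apply/set1P/permP=> x; rewrite perm1.
    have [Sx | S'x] := boolP (x \in S); first exact: fixY.
    by apply: out_perm S'x; apply: onX; apply: (subsetP sYX).
  have pXX : p.-group X by rewrite /pgroup -cardXY Y1 cards1 mul1n pnat_id.
  by rewrite pcore_pgroup_id // -[RHS]block_group_part part_pnat_id.
have p'XY : p^'.-nat #|X : Y|.
  rewrite -card_quotient //; apply: sub_pgroup qXY => r; rewrite !inE => /eqP->.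
  exact: neq.
have sylP : p.-Sylow(X) 'O_p(Y).
  have sylY : p.-Sylow(Y) 'O_p(Y) by apply: nilpotent_pcore_Hall; apply/abelian_nil/cyclic_abelian.
  rewrite /pHall (subset_trans (pcore_sub _ _) sYX) pcore_pgroup /=.
  rewrite -(Lagrange_index sYX (pcore_sub _ _)) pnatM p'XY.
  by have /and3P[_ _ ->] := sylY.
have nP : 'O_p(Y) <| X by apply: char_normal_trans (pcore_char _ _) nYX.
by rewrite (normal_Hall_pcore sylP nP) (card_Hall sylP) block_group_part.
Qed.

End BlockGroup.

Lemma quasi_elementaryS (gT : finGroupType) q (H K : {group gT}) :
  K \subset H -> quasi_elementary q H -> quasi_elementary q K.
Proof.
move=> sKH [C [cycC nCH q'C qHC]]; exists (C :&: K)%G.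
have nCK : K \subset 'N(C) by rewrite (subset_trans sKH) ?normal_norm.
split; first exact: cyclicS (subsetIl _ _) cycC.
- by rewrite /normal subsetIr normsI ?normG.
- exact: pgroupS (subsetIl _ _) q'C.
rewrite /pgroup; have <-: #|K / C| = #|K / (C :&: K)|; last exact: pgroupS (quotientS _ sKH) qHC.
  rewrite card_quotient // card_quotient ?normsI ?normG //.
  by rewrite [RHS]/= setIC indexgI.
Qed.

Lemma quasi_elementary_morphim (gT rT : finGroupType) q (D H : {group gT})
    (f : {morphism D >-> rT}) :
  H \subset D -> quasi_elementary q H -> quasi_elementary q (f @* H)%G.
Proof.
move=> sHD [C [cycC nCH q'C qHC]]; exists (f @* C)%G.
have sCH := normal_sub nCH; split; first exact: morphim_cyclic.
- exact: morphim_normal.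
- exact: morphim_pgroup.
rewrite /pgroup card_quotient ?morphim_norms ?normal_norm //.
apply: pnat_dvd (index_morphim _ _) _; first by rewrite subIset ?sHD.
by rewrite -card_quotient ?normal_norm.
Qed.

(** * Blocks on which a group acts with order divisible by p *)

Section BlockSylow.

Variables (T I : finType) (lab : T -> I) (p : nat) (H : {group {perm T}}) (Om : {set I}).
Implicit Types (g h v : {perm T}) (x y : T) (i : I).
Hypothesis pr_p : prime p.

Definition block i : {set T} := [set x | lab x == i].

Definition block_act (G : {group {perm T}}) i : {group {perm T}} :=
  (restr_perm (block i) @* 'N_G(block i | 'P))%G.

Hypothesis cardOm : {in Om, forall i, #|block i| = p}.
Hypothesis Hlab : forall g x y, g \in H -> lab x = lab y -> lab (g x) = lab (g y).
Hypothesis HOm : forall g x, g \in H -> lab x \in Om -> lab (g x) \in Om.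

Definition singular_blocks : {set I} := [set i in Om | p %| #|block_act H i|].

Hypothesis oOp : {in singular_blocks, forall i, #|'O_p(block_act H i)| = p}.

Lemma block_imset h x : h \in H -> h @: block (lab x) = block (lab (h x)).
Proof.
move=> Hh; apply/setP=> y; rewrite inE; apply/imsetP/eqP=> [[z] | Ey].
  by rewrite inE => /eqP Ez ->; apply: Hlab.
exists (h^-1 y); last by rewrite permKV.
by rewrite inE; have:= Hlab (groupVr Hh) Ey; rewrite permK => ->.
Qed.

Lemma restr_permJ (S : {set T}) (g h : {perm T}) : g \in 'N(S | 'P) ->
  restr_perm (h @: S) (g ^ h) = restr_perm S g ^ h.
Proof.
move=> Ng; have Ngh: g ^ h \in 'N(h @: S | 'P).
  by apply/astabs_permP/eqP; rewrite imset_permJ; apply/eqP/astabs_permP.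
apply/permP=> y; rewrite -[y](permKV h) permJ; set x := h^-1 y.
have memhS: (h x \in h @: S) = (x \in S) by rewrite mem_imset //; apply: perm_inj.
have [Sx | S'x] := boolP (x \in S); first by rewrite !restr_permE ?permJ ?memhS.
by rewrite !(out_perm (restr_perm_on _ _)) ?memhS.
Qed.

Lemma block_actJ h x : h \in H -> block_act H (lab (h x)) :=: block_act H (lab x) :^ h.
Proof.
have sub (k : {perm T}) y: k \in H -> block_act H (lab y) :^ k \subset block_act H (lab (k y)).
  move=> Hk; apply/subsetP=> _ /imsetP[_ /morphimP[g Ng /setIP[Hg _] ->] ->].
  rewrite -restr_permJ // block_imset //.
  have NgJ: g ^ k \in 'N(block (lab (k y)) | 'P).
    by rewrite -block_imset //; apply/astabs_permP/eqP; rewrite imset_permJ; apply/eqP/astabs_permP.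
  by apply: mem_morphim => //; rewrite inE groupJ.
move=> Hh; apply/eqP; rewrite eqEsubset sub // andbT.
by have := sub h^-1 (h x) (groupVr Hh); rewrite permK sub_conjgV.
Qed.

Lemma singular_blockJ h x : h \in H ->
  (lab (h x) \in singular_blocks) = (lab x \in singular_blocks).
Proof.
move=> Hh; rewrite !inE block_actJ // cardJg; congr (_ && _).
apply/idP/idP=> [/(HOm (groupVr Hh)) | ]; last exact: HOm.
by rewrite permK.
Qed.

Lemma block_act_on i : {in block_act H i, forall v, perm_on (block i) v}.
Proof. by move=> _ /morphimP[g _ _ ->]; apply: restr_perm_on. Qed.

Lemma pcore_on i : {in 'O_p(block_act H i)%G, forall v, perm_on (block i) v}.
Proof. by move=> x /(subsetP (pcore_sub _ _)) /block_act_on. Qed.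

(** The direct product, over the singular blocks, of the p-cores of the block actions, described
    through restrictions to blocks. *)
Definition block_sylow_set : {set {perm T}} :=
  [set v : {perm T} | [forall x, lab (v x) == lab x] &&
     [forall x, (lab x \notin singular_blocks) ==> (v x == x)] &&
     [forall i in singular_blocks, restr_perm (block i) v \in 'O_p(block_act H i)]].

Lemma block_sylowP v : reflect
  [/\ forall x, lab (v x) = lab x, forall x, lab x \notin singular_blocks -> v x = x
    & {in singular_blocks, forall i, restr_perm (block i) v \in 'O_p(block_act H i)}]
  (v \in block_sylow_set).
Proof.
rewrite inE -andbA; apply: (iffP and3P) => [[/forallP h1 /forallP h2 /forall_inP h3] | [h1 h2 h3]].
  by split=> // x; [apply/eqP | move/(implyP (h2 x))/eqP].
split; [apply/forallP=> x; exact/eqP | | exact/forall_inP].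
by apply/forallP=> x; apply/implyP=> /h2->.
Qed.

Lemma lab_preserving_norm (v : {perm T}) i : (forall x, lab (v x) = lab x) -> v \in 'N(block i | 'P).
Proof.
move=> labv; apply/astabs_permP/eqP; rewrite eqEcard card_imset ?leqnn ?andbT; last exact: perm_inj.
by apply/subsetP=> _ /imsetP[x + ->]; rewrite !inE labv.
Qed.

Lemma block_sylow_group_set : group_set block_sylow_set.
Proof.
apply/group_setP; split=> [|u v /block_sylowP[u1 u2 u3] /block_sylowP[v1 v2 v3]].
  by apply/block_sylowP; split=> [x|x _|i _]; rewrite ?perm1 ?morph1 ?group1.
apply/block_sylowP; split=> [x|x Wx|i Wi]; first by rewrite permM v1.
  by rewrite permM u2 ?v2.
by rewrite morphM ?lab_preserving_norm // groupM ?u3 ?v3.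
Qed.

Definition block_sylow : {group {perm T}} := Group block_sylow_group_set.

Lemma block_sylow_norm : H \subset 'N(block_sylow).
Proof.
apply/subsetP=> h Hh; rewrite inE; apply/subsetP=> _ /imsetP[v /block_sylowP[v1 v2 v3] ->].
apply/block_sylowP; split=> [x|x Wx|i Wi].
- rewrite -(permKV h x) permJ; apply: Hlab => //; exact: v1.
- by rewrite -(permKV h x) permJ v2 // singular_blockJ // groupV.
have /card_gt0P[x] : 0 < #|block i|.
  by rewrite cardOm ?prime_gt0 //; move: Wi; rewrite inE => /andP[].
rewrite inE => /eqP Exi; have Ei: i = lab (h (h^-1 x)) by rewrite permKV.
have Wx: lab (h^-1 x) \in singular_blocks by rewrite singular_blockJ ?groupV // Exi.
rewrite Ei -block_imset // restr_permJ ?lab_preserving_norm // block_actJ // pcoreJ.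
by rewrite memJ_conjg v3.
Qed.

Definition block_hull : {group {perm T}} := (H <*> block_sylow)%G.

Lemma block_hullP f : f \in block_hull -> exists h v, [/\ h \in H, v \in block_sylow & f = h * v].
Proof.
have EF: block_hull = H * block_sylow :> {set _} := norm_joinEl block_sylow_norm.
move=> Ff; have: f \in H * block_sylow by rewrite -EF.
case/mulsgP=> h v Hh Vv ->.
by exists h, v.
Qed.

Lemma block_hull_lab g x y : g \in block_hull -> lab x = lab y -> lab (g x) = lab (g y).
Proof.
move=> /block_hullP[h [v [Hh /block_sylowP[v1 _ _] ->]]] Exy.
by rewrite !permM !v1; apply: Hlab.
Qed.

(** Each p-core has order [p] on a block of [p] points, hence acts regularly on it. An element
    carrying one transversal to another is assembled block by block. *)
Lemma block_hull_sylow_setting : block_setting lab block_hull block_sylow singular_blocks.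
Proof.
have inOm i: i \in singular_blocks -> i \in Om by rewrite inE => /andP[].
split.
- by rewrite /normal joing_subr join_subG block_sylow_norm normG.
- exact: block_hull_lab.
- move=> g x /block_hullP[h [v [Hh /block_sylowP[v1 _ _] ->]]].
  by rewrite permM v1 singular_blockJ.
- by move=> v x /block_sylowP[].
- move=> v x y /block_sylowP[v1 v2 v3] Exy vx.
  have [Wx | W'x] := boolP (lab x \in singular_blocks); last by apply: v2; rewrite -Exy.
  have Nv := lab_preserving_norm (lab x) v1.
  have Bx: x \in block (lab x) by rewrite inE.
  have By: y \in block (lab x) by rewrite inE Exy.
  have r1: restr_perm (block (lab x)) v = 1.
    apply: (prime_block_free pr_p (cardOm (inOm _ Wx)) (oOp Wx) (@pcore_on _) Bx (v3 _ Wx)).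
    by rewrite restr_permE.
  by rewrite -(restr_permE Nv By) r1 perm1.
move=> U U' ptU ptU' EU; have [/ptransP[UW injU] /ptransP[U'W injU']] := (ptU, ptU').
set D := lab @: U in EU *.
have kP i : exists k : {perm T}, i \in D ->
    k \in 'O_p(block_act H i) /\ forall x, x \in U -> lab x = i -> k x \in U'.
  have [Di | _] := boolP (i \in D); last by exists 1.
  have /imsetP[x Ux Exi] := Di; have: i \in lab @: U' by rewrite -EU.
  case/imsetP=> y U'y Eyi; have Wi: i \in singular_blocks by rewrite Exi UW.
  have [||k Kk kx] := prime_block_trans pr_p (cardOm (inOm _ Wi)) (oOp Wi) (@pcore_on _) _ _ (x := x) (y := y).
  - by rewrite inE Exi.
  - by rewrite inE Eyi.
  exists k => _; split=> // x' Ux' Ex'i.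
  by rewrite (injU x' x) // ?kx // Ex'i.
have [k kE] := fin_all_exists kP.
pose f x := if lab x \in D then k (lab x) x else x.
have labk i x: i \in D -> lab (k i x) = i <-> lab x = i.
  move=> Di; have [Kk _] := kE i Di; have := perm_closed x (pcore_on Kk).
  by rewrite !inE => E; split=> /eqP; rewrite ?E // => Ex; apply/eqP; rewrite ?E // -E.
have labf x: lab (f x) = lab x.
  by rewrite /f; case: ifP => // Dx; apply/labk.
have f_inj : injective f.
  move=> x y Exy; have Elab: lab x = lab y by rewrite -labf Exy labf.
  by move: Exy; rewrite /f -Elab; case: ifP => // _ /perm_inj.
have vU: perm f_inj @: U = U'.
  apply/eqP; rewrite eqEcard card_imset; last exact: perm_inj.
  have /andP[_ /eqP <-] := ptU; have /andP[_ /eqP <-] := ptU'; rewrite -EU leqnn andbT.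
  apply/subsetP=> _ /imsetP[x Ux ->]; rewrite permE /f.
  have Dx: lab x \in D by apply: imset_f.
  by rewrite Dx; have [_ ->] := kE _ Dx.
exists (perm f_inj) => //; apply/fixingP; split=> [|x D'x]; last by rewrite permE /f (negPf D'x).
have labpf x: lab (perm f_inj x) = lab x by rewrite permE labf.
have sDW i : i \in D -> i \in singular_blocks by case/imsetP=> x Ux ->; apply: UW.
apply/block_sylowP; split=> // [x W'x | i Wi].
  by rewrite permE /f ifN //; apply: contra W'x; apply: sDW.
have Nf := lab_preserving_norm i labpf.
suff ->: restr_perm (block i) (perm f_inj) = if i \in D then k i else 1.
  by case: ifP => [/kE[] | _].
apply/permP=> x; have [Bx | B'x] := boolP (x \in block i).
  rewrite restr_permE // permE /f; move: Bx; rewrite inE => /eqP->.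
  by case: ifP; rewrite ?perm1.
rewrite (out_perm (restr_perm_on _ _)) //; case: ifP; rewrite ?perm1 // => Di.
by have [Kk _] := kE i Di; rewrite (out_perm (pcore_on Kk)).
Qed.

End BlockSylow.

(** If the order of [y] were prime to [p], the stabiliser of [u] in [K <[y]>] would have the order
    of [<[y]>], because the orbit has [p] points. By Schur-Zassenhaus it is conjugate to [<[y]>]
    under some [z] in [K], so [y] would fix [z^-1 u]. *)
Lemma prime_block_fixfree (T : finType) (p : nat) (S : {set T}) (K X : {group {perm T}}) y :
    prime p -> #|S| = p -> {in X, forall x, perm_on S x} -> K <| X -> #|K| = p ->
    y \in X -> {in S, forall x, y x != x} ->
  p %| #[y].
Proof.
move=> pr_p cardS onX nKX oK Xy ffy; apply: contraTT (pr_p) => p'y.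
have [sKX nXK] := andP nKX.
have onK : {in K, forall k, perm_on S k} by move=> k Kk; apply: onX; apply: (subsetP sKX).
have nKY: <[y]> \subset 'N(K) by rewrite cycle_subG (subsetP nXK).
have coKY: coprime #|K| #|<[y]>| by rewrite oK -orderE prime_coprime.
have /card_gt0P[u Su] : 0 < #|S| by rewrite cardS prime_gt0.
pose D := (K <*> <[y]>)%G.
have DE : D = K * <[y]> :> {set _} by rewrite /= norm_joinEr.
have sDX : D \subset X by rewrite join_subG sKX cycle_subG.
have oD : orbit 'P D u = S.
  apply/eqP; rewrite eqEsubset; apply/andP; split.
    apply/subsetP=> _ /orbitP[k Dk <-]; rewrite /= apermE perm_closed //.
    by apply: onX; apply: (subsetP sDX).
  apply/subsetP=> z Sz; have [k Kk <-] := prime_block_trans pr_p cardS oK onK Su Sz.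
  by rewrite (mem_orbit 'P) // (subsetP (joing_subl _ _)).
pose K1 := 'C_D[u | 'P]%G.
have cardK1 : #|K1| = #|<[y]>|.
  apply/eqP; rewrite -(eqn_pmul2l (prime_gt0 pr_p)) -{1}cardS -oD card_orbit_stab.
  by rewrite DE coprime_cardMg // oK.
have [||z Kz EK1] := @SchurZassenhaus_trans_sol _ K <[y]>%G K1 _ nKY _ coKY cardK1.
- by apply: (@pgroup_sol _ p); rewrite /pgroup oK pnat_id.
- by rewrite -DE subsetIl.
have : y ^ z \in K1 by rewrite EK1 memJ_conjg cycle_id.
case/setIP=> _ /astab1P /= Efix; have := ffy (z^-1 u).
rewrite (perm_closed _ (perm_onV (onK z Kz))) => /(_ Su) /negP[].
by rewrite -(inj_eq (@perm_inj _ z)) permKV -permJ permKV; apply/eqP.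
Qed.

(** * Induction inside the hull [F = H V] *)

Section BlockHull.

Variables (T I : finType) (lab : T -> I) (p : nat) (H : {group {perm T}}) (Om : {set I}).
Implicit Types (g h v : {perm T}) (x y : T) (i : I).
Hypothesis pr_p : prime p.
Hypothesis cardOm : {in Om, forall i, #|block lab i| = p}.
Hypothesis Hlab : forall g x y, g \in H -> lab x = lab y -> lab (g x) = lab (g y).
Hypothesis HOm : forall g x, g \in H -> lab x \in Om -> lab (g x) \in Om.

Let Wn := singular_blocks lab p H Om.
Let V := block_sylow lab p H Om.
Let F := block_hull lab p H Om.
Let X := block_act lab H.

Hypothesis oOp : {in Wn, forall i, #|'O_p(X i)| = p}.

Lemma hull_factor f i : f \in F -> f \in 'N(block lab i | 'P) -> exists h v,
  [/\ v \in V, restr_perm (block lab i) h \in X i, f = h * v,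
      h \in 'N(block lab i | 'P) & v \in 'N(block lab i | 'P)].
Proof.
move=> /(block_hullP pr_p cardOm Hlab HOm)[h [v [Hh Vv ->]]] Nhv.
have /block_sylowP[v1 v2 v3] := Vv; have Nv := lab_preserving_norm i v1.
have Nh : h \in 'N(block lab i | 'P) by rewrite groupMr in Nhv.
exists h, v; split=> //; apply: mem_morphim => //.
by rewrite inE Hh.
Qed.

Lemma hull_restr_singular f i : i \in Wn -> f \in F -> f \in 'N(block lab i | 'P) ->
  restr_perm (block lab i) f \in X i.
Proof.
move=> Wi Ff /(hull_factor Ff)[h [v [/block_sylowP[_ _ v3] Xh -> Nh Nv]]].
by rewrite morphM // groupM // (subsetP (pcore_sub _ _) _ (v3 i Wi)).
Qed.

Lemma hull_restr_regular f i : i \in Om -> i \notin Wn -> p.-elt f -> f \in F ->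
  f \in 'N(block lab i | 'P) -> {in block lab i, forall x, f x = x}.
Proof.
move=> Oi Wi p_f Ff Nf x Bx.
have [h [v [/block_sylowP[_ v2 _] Xh Df Nh Nv]]] := hull_factor Ff Nf.
have rv : restr_perm (block lab i) v = 1.
  apply/permP=> y; rewrite perm1; have [By | B'y] := boolP (y \in block lab i).
    by rewrite restr_permE // v2 //; move: By; rewrite inE => /eqP->.
  by rewrite (out_perm (restr_perm_on _ _)).
have Xf : restr_perm (block lab i) f \in X i.
  have ->: restr_perm (block lab i) f = restr_perm (block lab i) h * restr_perm (block lab i) v.
    by rewrite Df morphM.
  by rewrite rv mulg1.
rewrite -(restr_permE Nf Bx).
suff ->: restr_perm (block lab i) f = 1 by rewrite perm1.
have p'X : ~~ (p %| #|X i|) by move: Wi; rewrite inE Oi.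
apply/eqP; rewrite -order_eq1; apply/eqP; apply: (@pnat_1 p).
  exact: morph_p_elt.
by apply: pnat_dvd (order_dvdG Xf) _; rewrite p'natE.
Qed.

Lemma hull_fixfree f i : i \in Wn -> f \in F -> f \in 'N(block lab i | 'P) ->
  {in block lab i, forall x, f x != x} -> p %| #[restr_perm (block lab i) f].
Proof.
move=> Wi Ff Nf fff; have Oi : i \in Om by move: Wi; rewrite inE => /andP[].
apply: (prime_block_fixfree pr_p (cardOm Oi) (@block_act_on _ _ lab H i)
  (pcore_normal p (X i)) (oOp Wi) (hull_restr_singular Wi Ff Nf)).
by move=> x Bx; rewrite restr_permE // fff.
Qed.

(** The condition is on p-subgroups because on nonsingular blocks only p-elements are sure to have
    fixed points. *)
Definition p_stabilizes (W : {set I}) c (L : {group {perm T}}) : Prop :=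
  forall R : {group {perm T}}, R \subset L -> p.-group R -> stabilizes_ptrans lab W c R.

(** To the transversal given by [vanishing_ind_span], a p-subgroup can add one point in every
    nonsingular block through [extend_ptrans]; this is why [c] is lowered by [#|Om :\: Wn|]. *)
Lemma hull_ind_span c (xi : 'CF(F)) : xi \in 'Z[irr F] ->
    (forall g, g \in F ->
       (forall U, ptrans lab Wn U -> g @: U = U -> #|U| < c - #|Om :\: Wn|) -> xi g = 0%R) ->
  ind_span (p_stabilizes Om c) xi.
Proof.
move=> Zxi xi0.
have sWO : Wn \subset Om by apply/subsetP=> i; rewrite inE => /andP[].
have FVW := block_hull_sylow_setting pr_p cardOm Hlab HOm oOp.
apply: ind_span_sub (vanishing_ind_span FVW Zxi xi0) => L sLF [U1 [pt1 nU1 le1]] R sRL pR.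
have sRF := subset_trans sRL sLF.
have RO g x : g \in R -> lab x \in Om -> lab (g x) \in Om.
  move=> Rg; have /(block_hullP pr_p cardOm Hlab HOm)[h [v [Hh /block_sylowP[v1 _ _] ->]]] := subsetP sRF g Rg.
  by rewrite permM v1; apply: HOm.
have Rlab g x y : g \in R -> lab x = lab y -> lab (g x) = lab (g y).
  by move=> Rg; apply: (bs_lab FVW); apply: (subsetP sRF).
have pt1O : ptrans lab Om U1 by have /andP[s1 c1] := pt1; rewrite /ptrans c1 (subset_trans s1).
have [||U [ptU nU sU1U sDU]] := @extend_ptrans _ _ _ R Om Rlab RO U1 (Om :\: Wn) pt1O _ (subsetDl _ _).
- exact: subset_trans sRL nU1.
- move=> i /setDP[Oi Wi]; have /card_gt0P[x] : 0 < #|block lab i| by rewrite cardOm ?prime_gt0.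
  move=> Bx; have Exi: lab x = i by apply/eqP; rewrite inE in Bx.
  exists x => // r Rr Erx; apply: (hull_restr_regular Oi Wi) Bx.
  - exact: mem_p_elt pR Rr.
  - exact: (subsetP sRF).
  apply/astabs_permP/eqP; rewrite eqEcard card_imset ?leqnn ?andbT; last exact: perm_inj.
  apply/subsetP=> _ /imsetP[y + ->]; rewrite !inE => /eqP Ey.
  by rewrite -Exi -Erx (Rlab r y x) // Ey.
exists U; split=> //; have /andP[_ /eqP <-] := ptU.
have dis : [disjoint lab @: U1 & Om :\: Wn].
  rewrite disjoint_subset; apply/subsetP=> i U1i; rewrite !inE negb_and negbK.
  by have /andP[/subsetP/(_ i U1i) + _] := pt1; rewrite inE => ->.
have : (lab @: U1) :|: (Om :\: Wn) \subset lab @: U by rewrite subUset imsetS.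
move/subset_leq_card; rewrite cardsU disjoint_setI0 // cards0 subn0; apply: leq_trans.
by have /andP[_ /eqP ->] := pt1; rewrite addnC -leq_subLR.
Qed.

End BlockHull.

(** * Vanishing conditions in terms of cycles of blocks *)

Section CycleTypes.

Variables (T I : finType) (lab : T -> I) (p : nat) (G : {group {perm T}}) (Om : {set I}).
Implicit Types (g h v s : {perm T}) (x y : T) (i : I).
Hypothesis pr_p : prime p.
Hypothesis cardOm : {in Om, forall i, #|block lab i| = p}.
Hypothesis Glab : forall g x y, g \in G -> lab x = lab y -> lab (g x) = lab (g y).
Hypothesis GOm : forall g x, g \in G -> lab x \in Om -> lab (g x) \in Om.
Hypothesis Gbase : forall v, (forall x, lab (v x) = lab x) ->
  (forall x, lab x \notin Om -> v x = x) -> v \in G.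

(** A coordinate-free substitute for the wreath cycle type: in [Wr], these blocks lie in cycles
    whose entry in normal form is a p-cycle. *)
Definition pcycle_blocks g : {set I} :=
  [set i in Om | [exists s in <[g]>, (s \in 'N(block lab i | 'P)) &&
     (p %| #[restr_perm (block lab i) s])]].

(** Solomon's theorem reduces to a quasi-elementary [H], and one induces through its hull. If [g] in
    the hull stabilises only small partial transversals, few singular blocks have a point fixed by
    the block stabiliser in [<[g]>]; all other singular blocks are in [pcycle_blocks g], which makes
    [xi g = 0]. *)
Theorem vanishing_p_stabilizes c (xi : 'CF(G)) : xi \in 'Z[irr G] ->
    (forall g, g \in G -> #|Om| < c + #|pcycle_blocks g| -> xi g = 0%R) ->
  ind_span (p_stabilizes lab p Om c) xi.
Proof.
move=> Zxi xi0; apply: ind_span_quasi_elementary => H q phi sHG pr_q qH Zphi.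
have Hlab g x y : g \in H -> lab x = lab y -> lab (g x) = lab (g y).
  by move/(subsetP sHG); apply: Glab.
have HOm g x : g \in H -> lab x \in Om -> lab (g x) \in Om.
  by move/(subsetP sHG); apply: GOm.
set Wn := singular_blocks lab p H Om.
have sWO : Wn \subset Om by apply/subsetP=> i; rewrite inE => /andP[].
have oOp : {in Wn, forall i, #|'O_p(block_act lab H i)| = p}.
  move=> i; rewrite inE => /andP[Oi pX].
  apply: (pcore_block_group pr_p (cardOm Oi) (@block_act_on _ _ lab H i) pX pr_q).
  by apply: quasi_elementary_morphim; [apply: subsetIr | apply: quasi_elementaryS qH; apply: subsetIl].
set F := block_hull lab p H Om.
have sHF : H \subset F by apply: joing_subl.
have sFG : F \subset G.
  rewrite join_subG sHG; apply/subsetP=> v /block_sylowP[v1 v2 _]; apply: Gbase => // x Ox.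
  by apply: v2; apply: contra Ox; apply: (subsetP sWO).
(* The projection formula leaves ['Res[F] xi] as a factor on [F], so the vanishing of [xi] carries
   over. *)
rewrite -(cfIndInd _ sFG sHF) -(cfResRes _ sHF sFG) cfIndM //.
apply: ind_span_Ind => //; apply: hull_ind_span => //.
  by rewrite mul_vchar ?cfInd_vchar ?cfRes_vchar.
move=> g Fg small; rewrite cfunE cfResE // xi0 ?mulr0 ?(subsetP sFG) //.
have sgF : <[g]> \subset F by rewrite cycle_subG.
have FVW := block_hull_sylow_setting pr_p cardOm Hlab HOm oOp.
pose J := [set i in Wn | [exists x in block lab i, forall r in <[g]>, (lab (r x) == lab x) ==> (r x == x)]].
have glab r x y : r \in <[g]>%G -> lab x = lab y -> lab (r x) = lab (r y).
  by move/(subsetP sgF); apply: (bs_lab FVW).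
have gW r x : r \in <[g]>%G -> lab x \in Wn -> lab (r x) \in Wn.
  by move/(subsetP sgF); apply: (bs_W FVW).
have pt0 : ptrans lab Wn set0 by rewrite /ptrans imset0 sub0set !cards0 eqxx.
have [|||U [ptU nU _ sJU]] := @extend_ptrans _ _ _ <[g]>%G Wn glab gW set0 J pt0.
- by apply/subsetP=> r _; apply/astabs_permP; rewrite imset0.
- by apply/subsetP=> i; rewrite inE => /andP[].
- move=> i; rewrite inE => /andP[_ /exists_inP[x + /forall_inP fx]]; rewrite inE => /eqP Ex.
  by exists x => // r gr /eqP Er; apply/eqP; apply: (implyP (fx r gr)).
have leJ : #|J| < c - #|Om :\: Wn|.
  apply: leq_ltn_trans (small U ptU _); last exact/astabs_permP/(subsetP nU)/cycle_id.
  by have /andP[_ /eqP <-] := ptU; apply: subset_leq_card.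
have sWJ : Wn \subset J :|: pcycle_blocks g.
  apply/subsetP=> i Wi; rewrite inE; apply/orP; have [Ji | J'i] := boolP (i \in J); [by left | right].
  rewrite inE (subsetP sWO) //=; set B := block lab i.
  (* The stabiliser of the block in [<[g]>] is generated by a single [s]; a fixed point of [s] in
     the block would put [i] in [J], so [s] has none. *)
  have /cyclicP[s Es] : cyclic (<[g]> :&: 'N(B | 'P)) by apply: cyclicS (subsetIl _ _) (cycle_cyclic g).
  have /setIP[gs Ns] : s \in <[g]> :&: 'N(B | 'P) by rewrite Es cycle_id.
  apply/exists_inP; exists s => //; rewrite Ns.
  apply: (hull_fixfree pr_p cardOm Hlab HOm oOp Wi) => //; first exact: (subsetP sgF).
  move=> x Bx; apply: contra J'i => /eqP sx; rewrite inE Wi /=.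
  apply/exists_inP; exists x => //; apply/forall_inP=> r gr; apply/implyP=> /eqP Er; apply/eqP.
  suff: r \in <[s]> by case/cycleP=> m ->; apply: permX_fix.
  rewrite -Es inE gr; apply/astabs_permP/eqP.
  rewrite eqEcard card_imset ?leqnn ?andbT; last exact: perm_inj.
  apply/subsetP=> _ /imsetP[y + ->]; move: Bx; rewrite !inE => /eqP Ex /eqP Ey.
  by rewrite -Ex -Er (glab r y x) // Ey.
have leW := leq_trans (subset_leq_card sWJ) (leq_card_setU _ _).
rewrite -(cardsID Wn Om) (setIidPr sWO) addnC.
apply: leq_ltn_trans (leq_add (leqnn _) leW) _.
by rewrite addnA ltn_add2r -ltn_subRL.
Qed.

End CycleTypes.

(** * Coordinates on the wreath product *)

Section Coordinates.

Variables (p w e : nat).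
Hypothesis p_gt0 : 0 < p.
Let n := (p * w + e)%N.
Implicit Types (x y : 'I_n) (k : 'I_w) (r : 'I_p) (g h : {perm 'I_n}).
Implicit Types (A : {set {perm 'I_w}}) (B : {set {perm 'I_p}}) (s : {perm 'I_w}) (a b : 'I_w -> {perm 'I_p}).

(* The block containing a point, [None] for the points of the tail. *)
Definition blk x : option 'I_w := insub (x %/ p).

Lemma pt_proof k r : k * p + r < n.
Proof.
apply: leq_trans (leq_addr _ _); rewrite mulnC; apply: (@leq_trans (p * k + p)).
  by rewrite ltn_add2l.
by rewrite -mulnSr leq_mul2l ltn_ord orbT.
Qed.

Definition pt k r : 'I_n := Ordinal (pt_proof k r).

Definition pos x : 'I_p := Ordinal (ltn_pmod x p_gt0).

Lemma blk_pt k r : blk (pt k r) = Some k.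
Proof.
rewrite /blk /= divnMDl // (divn_small (ltn_ord r)) addn0 insubT //.
by move=> lt_k; congr Some; apply: val_inj.
Qed.

Lemma pos_pt k r : pos (pt k r) = r.
Proof. by apply: val_inj; rewrite /= modnMDl modn_small. Qed.

Lemma pt_pos x k : blk x = Some k -> pt k (pos x) = x.
Proof.
rewrite /blk; case: insubP => // k' _ Ek [<-]; apply: val_inj => /=.
by rewrite Ek -divn_eq.
Qed.

Lemma blk_None x : (blk x == None) = (p * w <= x).
Proof.
rewrite /blk; case: insubP => [k lt_k _ | /negPf ge_k] /=; last first.
  by rewrite leqNgt mulnC -ltn_divLR ?ge_k.
by rewrite leqNgt mulnC -ltn_divLR ?lt_k.
Qed.

Lemma blk_Some x k : (blk x == Some k) = (x < p * w) && (x %/ p == k).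
Proof.
rewrite ltnNge -blk_None /blk; case: insubP => [k' lt_k' Ek' | ge_k] /=.
  by rewrite -Ek'.
by [].
Qed.

Lemma block_blk k : block blk (Some k) = [set x : 'I_n | (x < p * w) && (x %/ p == k)].
Proof. by apply/setP=> x; rewrite !inE blk_Some. Qed.

Lemma card_block k : #|block blk (Some k)| = p.
Proof.
rewrite -[RHS]card_ord -(card_imset _ (_ : injective (pt k))); last first.
  by move=> r r' /(congr1 pos); rewrite !pos_pt.
apply: eq_card => x; rewrite inE; apply/eqP/imsetP=> [Ex | [r _ ->]]; last exact: blk_pt.
by exists (pos x); rewrite ?pt_pos.
Qed.

Lemma wr_coordsP g (s : {perm 'I_w}) (a : 'I_w -> {perm 'I_p}) :
  reflect ((forall x, blk x = None -> g x = x) /\ forall k r, g (pt k r) = pt (s k) (a k r))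
          (wr_coords g s a).
Proof.
apply: (iffP andP) => [[/forallP h1 /forallP h2] | [h1 h2]]; split.
- by move=> x /eqP; rewrite blk_None => /(implyP (h1 x))/eqP.
- move=> k r; apply: val_inj; apply/eqP.
  by apply: (implyP (forallP (forallP (h2 (pt k r)) k) r)).
- by apply/forallP=> x; apply/implyP; rewrite -blk_None => /eqP /h1 ->.
apply/forallP=> x; apply/forallP=> k; apply/forallP=> r; apply/implyP=> /eqP Ex.
have ->: x = pt k r by apply: val_inj.
by rewrite h2.
Qed.

Definition compat g := (forall x, blk x = None -> g x = x) /\
  (forall x y, blk x = blk y -> blk (g x) = blk (g y)).

Lemma mem_blocks (S : {set 'I_n}) : reflect (exists k, S = block blk (Some k)) (S \in blocks p w n).
Proof.
apply: (iffP imsetP) => [[k _ ->] | [k ->]]; exists k; rewrite ?block_blk //.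
Qed.

Lemma stab_blocks g : g \in 'C[blocks p w n | ('P^*)^*] ->
  forall k, exists k', g @: block blk (Some k) = block blk (Some k').
Proof.
move/astab1P => /= Eg k.
have: g @: block blk (Some k) \in blocks p w n.
  by rewrite -Eg; apply/imsetP; exists (block blk (Some k)); [apply/mem_blocks; exists k | rewrite /= setactE].
by case/mem_blocks=> k' ->; exists k'.
Qed.

Lemma tailsetE : tailset p w n = [set x : 'I_n | blk x == None].
Proof. by apply/setP=> x; rewrite !inE blk_None. Qed.

Lemma Wr_compat g : g \in Wr p w e -> compat g.
Proof.
case/setIP=> /stab_blocks sB; rewrite tailsetE => /astabP Ctail.
have tail x: blk x = None -> g x = x by move=> Nx; apply: (Ctail x); rewrite inE Nx.
split=> // x y Exy; case Ey: (blk y) Exy => [k|] Ex; last by rewrite !tail ?Ey.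
have [k' Ek'] := sB k.
have mem z: blk z = Some k -> blk (g z) = Some k'.
  move=> Ez; have: g z \in block blk (Some k') by rewrite -Ek' imset_f // inE Ez.
  by rewrite inE => /eqP.
by rewrite !mem.
Qed.

Lemma compat_Some g x : compat g -> (blk (g x) == None) = (blk x == None).
Proof.
case=> tail _; apply/eqP/eqP=> Nx; last by rewrite tail.
by rewrite -(perm_inj (tail _ Nx)).
Qed.

Lemma compat_Wr g : compat g -> g \in Wr p w e.
Proof.
move=> cg; have [tail clab] := cg; apply/setIP; split; last first.
  by rewrite tailsetE; apply/astabP=> x; rewrite inE => /eqP Nx; apply: tail.
apply/astab1P; rewrite /= setactE; apply/eqP; rewrite eqEcard card_imset ?leqnn ?andbT; last first.
  by apply: act_inj.
apply/subsetP=> _ /imsetP[_ /mem_blocks[k ->] ->]; apply/mem_blocks.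
have /card_gt0P[x] : 0 < #|block blk (Some k)| by rewrite card_block.
rewrite inE => /eqP Ex; case Egx: (blk (g x)) => [k'|]; last first.
  by move/eqP: Egx; rewrite compat_Some // Ex.
exists k'; rewrite /= setactE; apply/eqP; rewrite eqEcard !card_block card_imset ?card_block ?leqnn ?andbT; last exact: perm_inj.
apply/subsetP=> _ /imsetP[y + ->]; rewrite !inE => /eqP Ey; rewrite /= apermE -Egx.
by apply/eqP/clab; rewrite Ey.
Qed.

Lemma WrX_lab g x y k : g \in WrX p w e -> blk x = Some k -> blk y = Some k -> blk (g x) = blk (g y).
Proof.
case/setIP=> /stab_blocks sB _ Ex Ey; have [k' Ek'] := sB k.
have mem z: blk z = Some k -> blk (g z) = Some k'.
  move=> Ez; have: g z \in block blk (Some k') by rewrite -Ek' imset_f // inE Ez.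
  by rewrite inE => /eqP.
by rewrite !mem.
Qed.

Lemma Wr_sub_WrX : Wr p w e \subset WrX p w e.
Proof.
rewrite /WrX /= astab1_set; apply: setIS; exact: astab_sub.
Qed.

Definition wr_perm_fun (s : {perm 'I_w}) (a : 'I_w -> {perm 'I_p}) x :=
  if blk x is Some k then pt (s k) (a k (pos x)) else x.

Lemma wr_perm_inj s a : injective (wr_perm_fun s a).
Proof.
move=> x y; rewrite /wr_perm_fun; case Ex: (blk x) => [k|]; case Ey: (blk y) => [k'|] //.
- move=> E; have := congr1 blk E; rewrite !blk_pt => -[/perm_inj Ek].
  have := congr1 pos E; rewrite !pos_pt Ek => /perm_inj Er.
  by rewrite -(pt_pos Ex) -(pt_pos Ey) Er Ek.
- by move=> E; move: Ey; rewrite -E blk_pt.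
by move=> E; move: Ex; rewrite E blk_pt.
Qed.

Definition wr_perm s a := perm (@wr_perm_inj s a).

Lemma wr_perm_coords s a : wr_coords (wr_perm s a) s a.
Proof.
apply/wr_coordsP; split=> [x Nx | k r]; rewrite permE /wr_perm_fun ?Nx //.
by rewrite blk_pt pos_pt.
Qed.

Lemma wr_coords_uniq g h s (a b : 'I_w -> {perm 'I_p}) :
  wr_coords g s a -> wr_coords h s b -> a =1 b -> g = h.
Proof.
move=> /wr_coordsP[g1 g2] /wr_coordsP[h1 h2] Eab; apply/permP=> x.
case Ex: (blk x) => [k|]; last by rewrite g1 ?h1.
by rewrite -(pt_pos Ex) g2 h2 Eab.
Qed.

Lemma wr_coords_inj g s s' a b : wr_coords g s a -> wr_coords g s' b -> s = s' /\ a =1 b.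
Proof.
move=> /wr_coordsP[_ g2] /wr_coordsP[_ h2].
have E k r : pt (s k) (a k r) = pt (s' k) (b k r) by rewrite -g2 -h2.
split=> [|k]; apply/permP.
  by move=> k; have := congr1 blk (E k (Ordinal p_gt0)); rewrite !blk_pt => -[].
by move=> r; have := congr1 pos (E k r); rewrite !pos_pt.
Qed.

Lemma wr_coordsM g h s s' (a b : 'I_w -> {perm 'I_p}) : wr_coords g s a -> wr_coords h s' b ->
  wr_coords (g * h) (s * s') (fun k => a k * b (s k)).
Proof.
move=> /wr_coordsP[g1 g2] /wr_coordsP[h1 h2]; apply/wr_coordsP.
split=> [x Nx | k r]; first by rewrite permM g1 ?h1.
by rewrite !permM g2 h2.
Qed.

Lemma wr_coords_Wr g s a : wr_coords g s a -> g \in Wr p w e.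
Proof.
case/wr_coordsP=> g1 g2; apply: compat_Wr; split=> // x y Exy.
case Ey: (blk y) Exy => [k|] Ex; last by rewrite !g1 ?Ex ?Ey.
by rewrite -(pt_pos Ex) -(pt_pos Ey) !g2 !blk_pt.
Qed.

Lemma Wr_coords g : g \in Wr p w e -> exists s, exists a, wr_coords g s a.
Proof.
move=> Wg; have cg := Wr_compat Wg; have [tail clab] := cg.
have [_ clabV] := Wr_compat (groupVr Wg).
have sP k : exists k', forall r, blk (g (pt k r)) = Some k'.
  case Ek: (blk (g (pt k (Ordinal p_gt0)))) => [k'|].
    by exists k' => r; rewrite -Ek; apply: clab; rewrite !blk_pt.
  by move/eqP: Ek; rewrite compat_Some // blk_pt.
have [s sE] := fin_all_exists sP.
have s_inj : injective s.
  move=> k k' E; pose r0 := Ordinal p_gt0.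
  have := clabV (g (pt k r0)) (g (pt k' r0)); rewrite !sE !permK !blk_pt E.
  by by move=> /(_ erefl)[].
have aP k : exists a : {perm 'I_p}, forall r, g (pt k r) = pt (s k) (a r).
  have a_inj : injective (fun r => pos (g (pt k r))).
    move=> r r' E; have : g (pt k r) = g (pt k r').
      by rewrite -(pt_pos (sE k r)) -(pt_pos (sE k r')) E.
    by move/perm_inj/(congr1 pos); rewrite !pos_pt.
  by exists (perm a_inj) => r; rewrite permE (pt_pos (sE k r)).
have [a aE] := fin_all_exists aP.
exists (perm s_inj), a; apply/wr_coordsP; split=> // k r.
by rewrite aE permE.
Qed.

Definition wr_set (A : {set {perm 'I_w}}) (B : {set {perm 'I_p}}) :=
  [set wr_perm u.1 u.2 | u : {perm 'I_w} * {ffun 'I_w -> {perm 'I_p}} in setX A [set f : {ffun 'I_w -> {perm 'I_p}} | f \in ffun_on (mem B)]].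

Lemma mem_wr_set A B g : reflect (exists s, exists a : 'I_w -> {perm 'I_p},
    [/\ s \in A, forall k, a k \in B & wr_coords g s a]) (g \in wr_set A B).
Proof.
apply: (iffP imsetP) => [[[s f] /setXP[/= As]] | [s [a [As Ba ga]]]].
  rewrite inE => /ffun_onP Bf ->; exists s, f; split=> //; exact: wr_perm_coords.
exists (s, [ffun k => a k]); first by rewrite inE /= As inE; apply/ffun_onP=> k; rewrite ffunE; apply: Ba.
by apply: wr_coords_uniq ga (wr_perm_coords _ _) _ => k; rewrite ffunE.
Qed.

Lemma card_wr_set A B : #|wr_set A B| = (#|A| * #|B| ^ w)%N.
Proof.
rewrite card_imset => [|[s f] [s' f'] /= E].
  by rewrite cardsX cardsE card_ffun_on card_ord.
have [-> Ef] := wr_coords_inj (wr_perm_coords s f) (eq_ind_r (fun g => wr_coords g s' f') (wr_perm_coords s' f') E).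
by congr (_, _); apply/ffunP.
Qed.

Lemma WrE : Wr p w e = wr_set setT setT :> {set _}.
Proof.
apply/setP=> g; apply/idP/mem_wr_set=> [/Wr_coords[s [a ga]] | [s [a [_ _ ga]]]].
  by exists s, a; split=> [|k|]; rewrite ?inE.
exact: wr_coords_Wr ga.
Qed.

Variables (C : {group {perm 'I_p}}) (Q : {group {perm 'I_w}}).

Lemma PwrSetE : PwrSet e C Q = wr_set Q C.
Proof.
apply/setP=> g; rewrite inE; apply/exists_inP/mem_wr_set => [[s Qs /existsP[a /andP[/forallP Ca ga]]] | [s [a [Qs Ca ga]]]].
  by exists s, a.
exists s => //; apply/existsP; exists [ffun k => a k]; apply/andP; split.
  by apply/forallP=> k; rewrite ffunE.
have /wr_coordsP[g1 g2] := ga; apply/wr_coordsP; split=> // k r.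
by rewrite ffunE.
Qed.

Lemma Pwr_set : Pwr e C Q = wr_set Q C :> {set _}.
Proof.
rewrite -PwrSetE /=; apply: gen_set_id; rewrite PwrSetE; apply/group_setP; split.
  apply/mem_wr_set; exists 1, (fun=> 1); split=> //.
  by apply/wr_coordsP; split=> [x|k r]; rewrite !perm1.
move=> g h /mem_wr_set[s [a [Qs Ca ga]]] /mem_wr_set[s' [b [Qs' Cb hb]]].
apply/mem_wr_set; exists (s * s'), (fun k => a k * b (s k)); split=> [|k|].
- exact: groupM.
- exact: groupM.
exact: wr_coordsM.
Qed.

(** The p-part of [w! * p!^w] is [#|Q| * p^w], as [p!] has p-part [p]. *)
Lemma Pwr_Sylow : prime p -> #|C| = p -> p.-Sylow([set: {perm 'I_w}]) Q ->
  p.-Sylow(Wr p w e) (Pwr e C Q).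
Proof.
move=> pr_p oC sylQ; rewrite pHallE; apply/andP; split.
  rewrite Pwr_set WrE; apply/subsetP=> g /mem_wr_set[s [a [_ _ ga]]].
  by apply/mem_wr_set; exists s, a; split=> [|k|]; rewrite ?inE.
rewrite Pwr_set WrE !card_wr_set oC (card_Hall sylQ) partnM ?cardG_gt0 ?expn_gt0 ?cardG_gt0 //.
rewrite partnX cardsT.
have -> : #|[set: {perm 'I_p}]| = p`! by rewrite cardsT perm.card_Sn.
by rewrite partn_fact_prime.
Qed.

End Coordinates.

(** * Permutations centralising a p-subgroup *)

(** This serves to move [L] so that one of its Sylow p-subgroups lies in [P]. *)
Lemma cfInd_conj (gT : finGroupType) (G L : {group gT}) x (phi : 'CF(L)) :
    L \subset G -> x \in G -> phi \in 'Z[irr L] ->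
  exists2 psi : 'CF(L :^ x), psi \in 'Z[irr (L :^ x)] & ('Ind[G] psi = 'Ind[G] phi)%R.
Proof.
move=> sLG Gx Zphi; pose isoL := conj_isom L x.
exists (cfIsom isoL phi).
  rewrite (cfun_sum_cfdot phi) linear_sum rpred_sum // => i _.
  rewrite linearZ /= scale_zchar ?Cint_cfdot_vchar_irr //.
  by rewrite char_vchar // cfIsom_char irr_char.
apply/cfun_inP=> g Gg; rewrite !cfIndE ?conj_subG // cardJg; congr (_ * _)%R.
rewrite (reindex_inj (mulIg x)) /=; apply: eq_big => y; first by rewrite groupMr.
move=> _; rewrite conjgM; have [Ly | L'y] := boolP (g ^ y \in L).
  by rewrite -(cfIsomE isoL phi Ly) /= conjgmE.
by rewrite !cfun0 // memJ_conjg.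
Qed.

Section Normaliser.

Variables (p w e c : nat).
Hypotheses (pr_p : prime p) (ce : (1 < c) || (0 < c) && (0 < e)).
Let n := (p * w + e)%N.
Implicit Types (x y u v : 'I_n) (g : {perm 'I_n}) (R L : {group {perm 'I_n}}).

Let p_gt0 := prime_gt0 pr_p.

Definition full_blocks : {set option 'I_w} := [set i | i != None].

Lemma blockmate u k : blk u = Some k -> exists2 u', blk u' = Some k & u' != u.
Proof.
move=> Eu; have: 1 < #|block (@blk p w e) (Some k)| by rewrite card_block // prime_gt1.
rewrite (cardsD1 u) inE Eu eqxx ltnS => /card_gt0P[u' /setD1P[ne]].
by rewrite inE => /eqP Eu'; exists u'.
Qed.

Lemma notin_WrX g u k : blk u = Some k -> blk (g u) <> Some k ->
  (forall u', blk u' = Some k -> u' != u -> g u' = u') -> g \notin WrX p w e.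
Proof.
move=> Eu Egu fixg; apply/negP=> Wg; have [u' Eu' ne] := blockmate Eu.
by case: Egu; rewrite (WrX_lab p_gt0 Wg Eu Eu') fixg.
Qed.

Lemma centralising_outside R :
    R \subset Wr p w e -> p.-group R -> stabilizes_ptrans (@blk p w e) full_blocks c R ->
  exists2 g, g \in 'C(R) & g \notin WrX p w e.
Proof.
move=> sRW pR [U [/ptransP[UW injU] /subsetP nU leU]].
have USome u : u \in U -> exists k, blk u = Some k.
  by move/UW; rewrite inE; case: (blk u) => // k _; exists k.
have RU r u : r \in R -> u \in U -> r u \in U.
  by move=> /nU/astabs_permP rU Uu; rewrite -rU imset_f.
have [fixU | /forall_inPn[u Uu nfix]] := boolP [forall u in U, 'C_R[u | 'P] == R].
  have fixR u r : u \in U -> r \in R -> r u = u.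
    move=> Uu; have /eqP <- := forall_inP fixU u Uu.
    by case/setIP=> _ /astab1P.
  have U0 : 0 < #|U|.
    by apply: leq_trans leU; case/orP: ce => [/ltnW | /andP[]].
  have [u Uu] := card_gt0P U0; have [k Eu] := USome u Uu.
  (* When [R] fixes [U] pointwise, [u] is exchanged with a fixed point [v] outside its block: a
     second point of [U] if [1 < c], a point of the tail if [0 < e]. *)
  have [v Ev fixv] : exists2 v, blk v != Some k & forall r, r \in R -> r v = v.
    case/orP: ce => [c_gt1 | /andP[_ e_gt0]].
      have: 1 < #|U| by apply: leq_trans leU.
      rewrite (cardsD1 u) Uu ltnS => /card_gt0P[v /setD1P[ne Uv]].
      exists v => [|r]; last exact: fixR.
      by rewrite -Eu; apply: contra ne => /eqP /injU->.
    have lt_n : p * w < n by rewrite -addn1 leq_add2l.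
    have Nv : blk (Ordinal lt_n : 'I_(p * w + e)) = None by apply/eqP; rewrite blk_None.
    exists (Ordinal lt_n) => [|r Rr]; first by rewrite Nv.
    by have [tail _] := Wr_compat p_gt0 (subsetP sRW r Rr); apply: tail.
  exists (tperm u v).
    apply/centP=> r Rr; apply/commgP/conjg_fixP; rewrite tpermJ.
    by rewrite fixR ?fixv.
  apply: (notin_WrX Eu); first by rewrite tpermL; apply/eqP.
  move=> u' Eu' ne; apply: tpermD; first by rewrite eq_sym.
  by apply: contraNneq Ev => ->; apply/eqP.
set Ru := 'C_R[u | 'P]%G in nfix.
have prRu : Ru \proper R by rewrite properEneq nfix subsetIl.
(* Normalisers grow in p-groups: [z] normalises [Ru] without lying in it, so [u] and [z u] have the
   same stabiliser in [R]. *)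
have /properP[_ [z /setIP[Rz nRuz] Ruz]] := nilpotent_proper_norm (pgroup_nil pR) prRu.
have RuP r : r \in R -> (r \in Ru) = (r u == u).
  by move=> Rr; rewrite inE Rr /=; apply/astab1P/eqP.
have zRu r : r \in R -> (r u == u) = (r (z u) == z u).
  move=> Rr; have Rzr : r ^ z^-1 \in R by rewrite groupJ ?groupV.
  rewrite -RuP // -(memJ_norm _ (groupVr nRuz)) RuP // -(inj_eq (@perm_inj _ z)).
  by rewrite -permJ conjgKV.
(* [f] sends [r u] to [r (z u)] and fixes all points outside the [R]-orbit of [u]. It is well
   defined since the stabilisers of [u] and [z u] agree, and it commutes with [R]. *)
pose f x := if [pick r in R | r u == x] is Some r then r (z u) else x.
have fE r : r \in R -> f (r u) = r (z u).
  move=> Rr; rewrite /f; case: pickP => [r' /andP[Rr' /eqP E] | /(_ r)]; last by rewrite Rr eqxx.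
  apply/eqP; rewrite -(inj_eq (@perm_inj _ r^-1)) permK -permM -zRu ?groupM ?groupV //.
  by rewrite permM E permK.
have f_out x : (forall r, r \in R -> r u <> x) -> f x = x.
  by move=> nx; rewrite /f; case: pickP => // r /andP[Rr /eqP E]; case: (nx r Rr).
have orbP x : (exists2 r, r \in R & r u = x) \/ (forall r, r \in R -> r u <> x).
  have [/exists_inP[r Rr /eqP E] | nx] := boolP [exists r in R, r u == x]; first by left; exists r.
  by right=> r Rr E; case/exists_inP: nx; exists r => //; apply/eqP.
have f_inj : injective f.
  have diff r y : r \in R -> (forall s, s \in R -> s u <> y) -> f (r u) = f y -> r u = y.
    move=> Rr ny; rewrite fE // f_out // -permM => E; case: (ny (z * r)) => //.
    exact: groupM.
  move=> x y; case: (orbP x) => [[r Rr <-]|nx]; case: (orbP y) => [[s Rs <-]|ny].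
  - rewrite !fE // => E; apply/eqP; rewrite -(inj_eq (@perm_inj _ s^-1)) permK -permM.
    by rewrite zRu ?groupM ?groupV // permM E permK.
  - exact: diff.
  - by move/esym/(diff s x Rs nx).
  - by rewrite !f_out.
have [k Eu] := USome u Uu.
exists (perm f_inj).
  apply/centP=> s Rs; apply/permP=> x; rewrite !permM !permE.
  case: (orbP x) => [[r Rr <-]|nx]; first by rewrite fE // -!permM fE ?groupM // permM.
  rewrite !f_out // => r Rr E; apply: (nx (r * s^-1)); first by rewrite groupM ?groupV.
  by rewrite permM E permK.
(* [z u] is a point of [U] other than [u], hence in another block. The orbit of [u] lies in [U], so
   the other points of the block of [u] are outside it and stay fixed. *)
apply: (notin_WrX Eu).
  rewrite permE -{1}[u](perm1 u) fE ?group1 // perm1 -Eu => /(injU _ _ (RU z u Rz Uu) Uu) E.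
  by case/negP: Ruz; rewrite RuP // E.
move=> u' Eu' ne; rewrite permE; apply: f_out => r Rr E; case/eqP: ne.
by rewrite -E; apply: injU => //; [apply: RU | rewrite E Eu Eu'].
Qed.

(** Conjugate inside [Wr] so that the Sylow subgroup [R :^ x] of [L :^ x] lies in [P]; it is then
    the whole intersection with [P]. The conjugate [g ^ x] centralises it and stays outside [WrX],
    as [x] lies in [WrX]. *)
Lemma p_stabilizes_Igen (P : {group {perm 'I_n}}) L (phi : 'CF(L)) :
    p.-Sylow(Wr p w e) P -> L \subset Wr p w e ->
    p_stabilizes (@blk p w e) p full_blocks c L -> phi \in 'Z[irr L] ->
  Igen p P (Sfam [set: {perm 'I_n}] P (WrX p w e)) ('Ind[Wr p w e] phi)%R.
Proof.
move=> sylP sLW stL Zphi; have [R sylR] := Sylow_exists p L.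
have [sRL pR _] := and3P sylR; have sRW := subset_trans sRL sLW.
have [x Wx sRxP] := Sylow_Jsub sylP sRW pR.
have [psi Zpsi <-] := cfInd_conj sLW Wx Zphi.
have [g cRg Wg] := centralising_outside sRW pR (stL R sRL pR).
have sylRx : p.-Sylow(L :^ x) (R :^ x) by rewrite pHallJ2.
have ELP : L :^ x :&: P = R :^ x.
  apply: (sub_pHall sylRx); last exact: subsetIl.
    exact: pgroupS (subsetIr _ _) (pHall_pgroup sylP).
  by rewrite subsetI conjSg sRL sRxP.
exists (L :^ x)%G; split; last by exists psi.
- by rewrite conj_subG.
- by rewrite inE /= ELP.
split; first exact: subsetIr.
exists (g ^ x).
  rewrite inE in_setT andbT; apply: contra Wg => Wgx.
  by rewrite -(conjgK x g) groupJ // groupV (subsetP (Wr_sub_WrX p w e)).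
rewrite ELP subsetI sRxP andbT.
have /normP <- : (g ^ x)^-1 \in 'N(R :^ x).
  by rewrite groupV (subsetP (cent_sub _)) // centJ memJ_conjg.
by rewrite conjSg.
Qed.

End Normaliser.

(** * Normal forms *)

(** Some power of [x] has order [p] and therefore acts transitively on the [p] points. *)
Lemma dvdn_order_pcycle p (x : {perm 'I_p}) : prime p -> p %| #[x] -> pcycle x.
Proof.
move=> pr_p pox; have p_gt0 := prime_gt0 pr_p.
have [z zx oz] := Cauchy pr_p (pox : p %| #|<[x]>%G|).
have onz : {in <[z]>%G, forall k, perm_on [set: 'I_p] k}.
  by move=> k _; apply/subsetP=> i _; rewrite inE.
have cT : #|[set: 'I_p]| = p by rewrite cardsT card_ord.
apply/existsP; exists (Ordinal p_gt0); suff -> : porbit x (Ordinal p_gt0) = [set: 'I_p] by rewrite cT.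
apply/setP=> y; rewrite inE.
have [k zk <-] := prime_block_trans pr_p cT oz onz (in_setT (Ordinal p_gt0)) (in_setT y).
have /cycleP[i ->] : k \in <[x]> by apply: subsetP zk; rewrite cycle_subG.
exact: mem_porbit.
Qed.

Section NormalForm.

Variables (p w e : nat).
Hypothesis pr_p : prime p.
Let n := (p * w + e)%N.
Let p_gt0 := prime_gt0 pr_p.
Implicit Types (x y : 'I_n) (k m : 'I_w) (r : 'I_p).

Variable g : {perm 'I_n}.

Variables (s : {perm 'I_w}) (a : 'I_w -> {perm 'I_p}).
Hypothesis ga : wr_coords g s a.

Let gtail x : blk x = None -> g x = x.
Proof. by have /(wr_coordsP p_gt0)[+ _] := ga; apply. Qed.

Let gpt k r : g (pt e k r) = pt e (s k) (a k r).
Proof. by have /(wr_coordsP p_gt0)[_] := ga; apply. Qed.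

Lemma blk_coords x k : blk x = Some k -> blk (g x) = Some (s k).
Proof. by move=> Ex; rewrite -(pt_pos p_gt0 Ex) gpt blk_pt. Qed.

Lemma blk_coordsX i x k : blk x = Some k -> blk ((g ^+ i) x) = Some ((s ^+ i) k).
Proof.
elim: i => [|i IH] Ex; first by rewrite !perm1.
by rewrite !expgSr !permM; apply: blk_coords; apply: IH.
Qed.

Definition least k : 'I_w := [arg min_(j < k in porbit s k) j].

Lemma least_in k : least k \in porbit s k.
Proof. by rewrite /least; case: arg_minnP => //; apply: porbit_id. Qed.

Lemma least_le k j : j \in porbit s k -> least k <= j.
Proof. by rewrite /least; case: arg_minnP => [|m _ minm /minm //]; apply: porbit_id. Qed.

Lemma porbit_least k : porbit s (least k) = porbit s k.
Proof. by apply/eqP; rewrite eq_porbit_mem least_in. Qed.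

Lemma least_eq k j : j \in porbit s k -> least j = least k.
Proof.
move=> kj; have E : porbit s j = porbit s k by apply/eqP; rewrite eq_porbit_mem.
apply/val_inj/eqP; rewrite eqn_leq !least_le //.
  by rewrite -E least_in.
by rewrite E least_in.
Qed.

Lemma least_step k : least (s k) = least k.
Proof. by apply: least_eq; have := mem_porbit s 1 k; rewrite expg1. Qed.

Lemma least_ptE k : least_pt s k = (least k == k).
Proof.
apply/forall_inP/eqP=> [lek | <- j].
  by apply/val_inj/eqP; rewrite eqn_leq lek ?least_in // least_le ?porbit_id.
by rewrite porbit_least => /least_le.
Qed.

Lemma dist_ex k : exists j, (s ^+ j) k == least k.
Proof. by have /porbitP[j ->] := least_in k; exists j. Qed.

Definition dist k := ex_minn (dist_ex k).

Lemma distP k : (s ^+ dist k) k = least k.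
Proof. by rewrite /dist; case: ex_minnP => j /eqP. Qed.

Lemma dist_min k j : (s ^+ j) k = least k -> dist k <= j.
Proof. by rewrite /dist => /eqP E; case: ex_minnP => i _; apply. Qed.

Lemma dist_step k : least k != k -> dist k = (dist (s k)).+1.
Proof.
move=> nk; apply/eqP; rewrite eqn_leq dist_min /=; last first.
  by rewrite expgS permM distP least_step.
have := distP k; case: (dist k) (@dist_min (s k)) => [|j] minj.
  by rewrite expg0 perm1 => E; rewrite -E eqxx in nk.
by rewrite expgS permM ltnS => E; apply: minj; rewrite least_step.
Qed.

(* Conjugating by this permutation puts [g] in normal form: every block is
   identified with the least block of its cycle by a power of [g]. *)
Definition untwist_fun x :=
  if blk x is Some k then pt e k (pos p_gt0 ((g ^+ dist k) x)) else x.

Lemma untwist_inj : injective untwist_fun.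
Proof.
have blku x : blk (untwist_fun x) = blk x.
  by rewrite /untwist_fun; case Ex: (blk x) => [k|] //; rewrite blk_pt.
move=> x y E; have := congr1 (@blk p w e) E; rewrite !blku; move: E; rewrite /untwist_fun.
case Ex: (blk x) => [k|]; case Ey: (blk y) => [k'|] // + [Ek]; rewrite -{k'}Ek in Ey *.
move/(congr1 (pos p_gt0)); rewrite !pos_pt => E.
apply: (@perm_inj _ (g ^+ dist k)).
by rewrite -(pt_pos p_gt0 (blk_coordsX (dist k) Ex)) -(pt_pos p_gt0 (blk_coordsX (dist k) Ey)) E.
Qed.

Definition untwist := perm untwist_inj.

Lemma untwistE x k : blk x = Some k -> untwist x = pt e k (pos p_gt0 ((g ^+ dist k) x)).
Proof. by move=> Ex; rewrite permE /untwist_fun Ex. Qed.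

Lemma blk_untwist x : blk (untwist x) = blk x.
Proof. by case Ex: (blk x) => [k|]; [rewrite (untwistE Ex) blk_pt | rewrite permE /untwist_fun Ex]. Qed.

Lemma untwist_Wr : untwist \in Wr p w e.
Proof.
apply: (compat_Wr p_gt0); split=> [x Nx | x y]; last by rewrite !blk_untwist.
by rewrite permE /untwist_fun Nx.
Qed.

Variable b : 'I_w -> {perm 'I_p}.
Hypothesis gb : wr_coords (g ^ untwist) s b.

Lemma untwist_pt k r x : blk x = Some k -> untwist x = pt e k r ->
  untwist (g x) = pt e (s k) (b k r).
Proof.
move=> Ex E; have /(wr_coordsP p_gt0)[_ <-] := gb.
by rewrite -E permJ.
Qed.

(** Away from the least block, applying [g] lowers [dist] by one. So the identifications of the
    blocks [k] and [s k] with the least block are compatible with [g], and the coordinate is 1. *)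
Lemma untwist_normal : normal_form s b.
Proof.
move=> k; apply: contraR; rewrite least_ptE => nk; apply/eqP/permP=> r; rewrite perm1.
have [x Ex] : exists x, untwist x = pt e k r by exists (untwist^-1 (pt e k r)); rewrite permKV.
have Bx : blk x = Some k by rewrite -blk_untwist Ex blk_pt.
have := untwist_pt Bx Ex; rewrite (untwistE (blk_coords Bx)) => /(congr1 (pos p_gt0)).
rewrite !pos_pt => <-; have := congr1 (pos p_gt0) Ex; rewrite (untwistE Bx) !pos_pt => <-.
by rewrite (dist_step nk) expgS permM.
Qed.

(** [(dist (s m)).+1] is the length of the cycle of [m], so the first return of [g] to the least
    block is the remaining coordinate [b m]. *)
Lemma untwist_least m r : least m = m ->
  (g ^+ (dist (s m)).+1) (pt e m r) = pt e m (b m r).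
Proof.
move=> lm; set x := pt e m r; have Bx : blk x = Some m by apply: blk_pt.
have d0 : dist m = 0 by apply/eqP; rewrite -leqn0 dist_min // perm1 lm.
have Ex : untwist x = pt e m r by rewrite (untwistE Bx) d0 perm1 pos_pt.
have := untwist_pt Bx Ex; rewrite (untwistE (blk_coords Bx)) => /(congr1 (pos p_gt0)).
rewrite !pos_pt expgS permM => <-; rewrite pt_pos //.
by rewrite (blk_coordsX _ (blk_coords Bx)) distP least_step lm.
Qed.

Lemma untwist_leastX m r j : least m = m ->
  (g ^+ ((dist (s m)).+1 * j)) (pt e m r) = pt e m ((b m ^+ j) r).
Proof.
move=> lm; elim: j r => [|j IH] r; first by rewrite muln0 !perm1.
by rewrite mulnS expgD permM untwist_least // IH expgS permM.
Qed.

Lemma period_dvdn m N : least m = m -> (s ^+ N) m = m -> (dist (s m)).+1 %| N.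
Proof.
move=> lm; set o := (dist (s m)).+1 => sN.
have so : (s ^+ o) m = m by rewrite expgS permM distP least_step lm.
have sr : (s ^+ (N %% o)) m = m.
  rewrite {1}(divn_eq N o) expgD permM mulnC expgM (permX_fix _ so) in sN.
  exact: sN.
rewrite /dvdn; case E: (N %% o) sr => [|j] // sr.
have : N %% o < o by rewrite ltn_mod.
rewrite E ltnS ltnNge dist_min //.
by rewrite least_step lm -[RHS]sr expgS permM.
Qed.

(** The power [h] of [g] commutes with [y = g ^+ dist k], so it acts on the least block as it does
    on block [k], with order divisible by [p]. On the least block it is a power of [b m] in the
    coordinates [pt]. *)
Lemma pcycle_block_least k : Some k \in pcycle_blocks (@blk p w e) p (@full_blocks w) g ->
  pcycle (b (least k)).
Proof.
rewrite inE => /andP[_ /exists_inP[c0 /cycleP[N ->] /andP[NgN pN]]].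
set m := least k; have lm : least m = m by apply/least_eq/least_in.
set h := g ^+ N in NgN pN.
set B := block (@blk p w e) (Some k) in NgN pN; set Bm := block (@blk p w e) (Some m).
set y := g ^+ dist k.
have blkE x k' : (x \in block (@blk p w e) (Some k')) = (blk x == Some k') by rewrite inE.
have ctail x : blk (y x) = Some m -> blk x = Some k.
  case Ex: (blk x) => [k'|].
    by rewrite (blk_coordsX _ Ex) /m -(distP k) => -[/perm_inj ->].
  by rewrite /y permX_fix ?gtail ?Ex.
have yB : y @: B = Bm.
  apply/setP=> x; rewrite blkE; apply/imsetP/eqP=> [[z + ->] | Ex].
    by rewrite blkE => /eqP Ez; rewrite (blk_coordsX _ Ez) distP.
  by exists (y^-1 x); rewrite ?permKV // blkE; apply/eqP/ctail; rewrite permKV.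
have hy : h ^ y = h by apply/conjg_fixP/commgP; apply: commuteX2.
have NhBm : h \in 'N(Bm | 'P).
  have /astabs_permP hB := NgN; apply/astabs_permP/eqP.
  by rewrite -{1}hy -yB imset_permJ hB.
have phBm : p %| #[restr_perm Bm h].
  by rewrite -yB -{1}hy restr_permJ // orderJ.
have Bpt r : pt e m r \in Bm by rewrite blkE blk_pt.
have sNm : (s ^+ N) m = m.
  have := Bpt (Ordinal p_gt0); rewrite -(astabs_act _ NhBm) /= apermE blkE.
  by rewrite (blk_coordsX _ (blk_pt e p_gt0 m _)) => /eqP[].
have /dvdnP[q Eq] := period_dvdn lm sNm.
apply: dvdn_order_pcycle => //; apply: dvdn_trans phBm _.
rewrite order_dvdn; apply/eqP/permP=> x; rewrite perm1 -morphX //.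
have [Bx | B'x] := boolP (x \in Bm); last by rewrite (out_perm (restr_perm_on _ _)).
rewrite (restr_permE (groupX _ NhBm) Bx); move: Bx; rewrite blkE => /eqP Ex.
rewrite -(pt_pos p_gt0 Ex) /h -expgM Eq [(q * _)%N]mulnC -mulnA untwist_leastX //.
by rewrite [(q * _)%N]mulnC expgM expg_order expg1n perm1.
Qed.

(** Blocks are grouped by the least point of their cycle; each group lies in one [s]-cycle, which
    [tp_size] counts by [pcycle_block_least]. *)
Lemma pcycle_blocks_tp : #|pcycle_blocks (@blk p w e) p (@full_blocks w) g| <= tp_size s b.
Proof.
set A := pcycle_blocks _ _ _ _; pose A' := [set k | Some k \in A].
have memA' k : (k \in A') = (Some k \in A) by rewrite /A' in_set.
have -> : #|A| = #|A'|.
  rewrite -(card_imset A' (@Some_inj _)); apply: eq_card => i; apply/idP/imsetP => [Ai | [k + ->]].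
    case: i Ai => [k|] Ai; first by exists k; rewrite ?memA'.
    by move: Ai; rewrite inE => /andP[]; rewrite inE.
  by rewrite memA'.
rewrite -sum1_card (partition_big least (fun k => least_pt s k && pcycle (b k))) /=.
  apply: leq_sum => m _; rewrite sum1_card; apply: subset_leq_card.
  apply/subsetP=> k; rewrite unfold_in => /andP[_ /eqP <-].
  by rewrite porbit_least porbit_id.
move=> k; rewrite memA' => Ak; rewrite pcycle_block_least // andbT least_ptE.
by apply/eqP/least_eq/least_in.
Qed.

End NormalForm.

Lemma pcycle_blocks_inU p w e t (g : {perm 'I_(p * w + e)}) : prime p -> g \in Wr p w e ->
  t <= #|pcycle_blocks (@blk p w e) p (@full_blocks w) g| -> inU t g.
Proof.
move=> pr_p Wg le_t; split=> //; have p_gt0 := prime_gt0 pr_p.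
have [s [a ga]] := Wr_coords p_gt0 Wg.
have Wu := untwist_Wr pr_p ga.
have [s' [b gb]] := Wr_coords p_gt0 (groupJ Wg Wu).
(* Untwisting keeps every point in its block, so it does not change the permutation of the
   blocks. *)
have Es : s' = s.
  apply/permP=> k; pose r0 := Ordinal p_gt0.
  have /(wr_coordsP p_gt0)[_ h2] := gb.
  pose x := (untwist pr_p ga)^-1 (pt e k r0).
  have Bx : blk x = Some k by rewrite -(blk_untwist pr_p ga) permKV blk_pt.
  have := congr1 (@blk p w e) (h2 k r0); rewrite -[pt e k r0](permKV (untwist pr_p ga)) permJ.
  by rewrite (blk_untwist pr_p ga) (blk_coords pr_p ga Bx) (blk_pt e p_gt0) => -[].
rewrite {}Es in gb.
exists (untwist pr_p ga) => //; exists s, b; split=> //.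
  exact: untwist_normal gb.
by apply: leq_trans le_t (pcycle_blocks_tp gb).
Qed.

(** [c] is the size of the partial transversals to be stabilised and [t] the threshold on cycle
    types; their relation puts [g] in the set where [xi] vanishes once [w < c + m], with [m] the
    number of its [pcycle_blocks]. *)
Lemma inK_inI p w e c t (C : {group {perm 'I_p}}) (Q : {group {perm 'I_w}})
    (xi : 'CF(Wr p w e)) :
    prime p -> #|C| = p -> p.-Sylow([set: {perm 'I_w}]) Q ->
    (1 < c) || (0 < c) && (0 < e) -> (forall m, w < c + m -> t <= m) -> inK t xi ->
  inI p (Pwr e C Q) (Sfam [set: {perm 'I_(p * w + e)}] (Pwr e C Q) (WrX p w e)) xi.
Proof.
move=> pr_p oC sylQ ce wct [Zxi xi0]; have p_gt0 := prime_gt0 pr_p.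
have cardB : {in @full_blocks w, forall i, #|block (@blk p w e) i| = p}.
  by move=> [k|]; rewrite inE // => _; apply: card_block.
have cardOm : #|@full_blocks w| = w.
  have -> : @full_blocks w = [set Some k | k : 'I_w].
    by apply/setP=> -[k|]; rewrite inE; apply/esym/imsetP; [exists k | case].
  by rewrite card_imset ?card_ord //; apply: Some_inj.
have Wlab (g : {perm 'I_(p * w + e)}) x y : g \in Wr p w e -> blk x = blk y -> blk (g x) = blk (g y).
  by move=> Wg; have [_] := Wr_compat p_gt0 Wg; apply.
have WOm (g : {perm 'I_(p * w + e)}) x : g \in Wr p w e ->
    blk x \in @full_blocks w -> blk (g x) \in @full_blocks w.
  by move=> Wg; rewrite !inE (compat_Some _ (Wr_compat p_gt0 Wg)).
have Wbase (v : {perm 'I_(p * w + e)}) : (forall x, blk (v x) = blk x) ->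
    (forall x, blk x \notin @full_blocks w -> v x = x) -> v \in Wr p w e.
  move=> v1 v2; apply: (compat_Wr p_gt0); split=> [x Nx | x y Exy]; last by rewrite !v1.
  by apply: v2; rewrite Nx inE.
have [|l Hl Exi] := vanishing_p_stabilizes pr_p cardB Wlab WOm Wbase (c := c) Zxi.
  move=> g Wg; rewrite cardOm => /wct le_t; apply: xi0.
  exact: pcycle_blocks_inU.
exists l => // y /Hl[L [sLW stL [phi Zphi ->]]].
by apply: (p_stabilizes_Igen pr_p ce); rewrite ?Pwr_Sylow.
Qed.

Theorem theorem4p1 (p w e : nat) (C : {group {perm 'I_p}}) (Q : {group {perm 'I_w}}) :
  prime p -> #|C| = p -> Q \in ('Syl_p([set: {perm 'I_w}]))%g ->
  (forall xi : 'CF(Wr p w 0), inK (w - 1) xi ->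
     inI p (Pwr 0 C Q)
       (Sfam [set: {perm 'I_(p * w + 0)}] (Pwr 0 C Q) (WrX p w 0)) xi) /\
  (0 < e -> forall xi : 'CF(Wr p w e), inK w xi ->
     inI p (Pwr e C Q)
       (Sfam [set: {perm 'I_(p * w + e)}] (Pwr e C Q) (WrX p w e)) xi).
Proof.
move=> pr_p oC; rewrite inE => sylQ; split=> [xi | e_gt0 xi].
  (* With [c = 2], [w < 2 + m] gives [w - 1 <= m], also when [w = 0] and the subtraction is
     truncated. In the second part the tail allows [c = 1], with threshold [w]. *)
  by apply: (@inK_inI _ _ _ 2) => // m; rewrite addSn ltnS leq_subLR.
by apply: (@inK_inI _ _ _ 1).
Qed.
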